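(* Let $X$ be an NPC space, let $G$ be a totally disconnected, locally compact group acting properly and continuously by isometries on $X$, and let $g \in G$ be hyperbolic, with attracting point $\xi_+$ and repelling point $\xi_-$. Then the following are equivalent: (i) $s_G(g)=1$; (ii) $s_{G_{\xi_+}}(g)=1$; (iii) $\Delta_{G_{\xi_+}}(g) = 1$; (iv) $G_{\xi_-}$ is open in $G$; (v) $G_{\xi_-,\xi_+} := G_{\xi_-}\cap G_{\xi_+}$ is open in $G_{\xi_+}$; (vi) $G_{\xi_+} \le G_{\xi_-}$; (vii) $\xi_+ \rightarrow \xi_-$.
   Context: An NPC space is a geodesic metric space $X$ that is either (a) complete and CAT(0), or (b) proper (closed balls are compact) and $\delta$-hyperbolic for some $\delta \ge 0$ (every geodesic triangle is $\delta$-thin: each point on a side lies within distance $\delta$ of a point on another side). The boundary $\partial X$ is the set of equivalence classes of geodesic rays, where $\gamma_1\sim\gamma_2$ if $d(\gamma_1(t),\gamma_2(t))$ is bounded over $t\ge 0$; isometries act on $\partial X$, and $G_\xi$ denotes the stabilizer of $\xi$ in $G$. Convergence of sequences in $X$ to boundary points is in the usual sense (cone topology for CAT(0) spaces, Gromov boundary for proper $\delta$-hyperbolic spaces). An isometry $g$ is hyperbolic if: in case (a), it has an axis, i.e. there are a geodesic line $\gamma:\mathbb{R}\to X$ and $k>0$ with $g\gamma(t)=\gamma(t+k)$ for all $t$; in case (b), $n\mapsto g^nx$ is a quasi-isometric embedding of $\mathbb{Z}$ into $X$ for some (equivalently any) $x$. A point $\xi\in\partial X$ is the attracting point $\xi_+(g)$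 of $g$ if $g^nx\to\xi$ as $n\to+\infty$ for all $x\in X$; the repelling point is $\xi_-(g):=\xi_+(g^{-1})$. For hyperbolic $g$ both exist and are distinct. An isometric action of $G$ on $X$ is proper if for all $x\in X$, $r>0$ the set $\{g\in G: d(gx,x)\le r\}$ has compact closure. $\partial^{\mathrm{hyp}}_X G$ denotes the set of points of $\partial X$ that are limit points (attracting or repelling points) of hyperbolic elements of $G$. For $\xi_1,\xi_2\in\partial^{\mathrm{hyp}}_X G$, write $\xi_1\rightarrow\xi_2$ if every hyperbolic $h\in G$ with attracting point $\xi_1$ has repelling point $\xi_2$. For a totally disconnected, locally compact group $H$ and $g\in H$, the scale $s_H(g)$ is the minimum of $|gUg^{-1}:U\cap gUg^{-1}|$ over all compact open subgroups $U$ of $H$. The modular function is $\Delta_H(g)=\mu(gU)/\mu(U)$, where $\mu$ is a right-invariant Haar measure on $H$ and $U$ is any compact open subgroup of $H$. *)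

(* Defs.v *)
From HB Require Import structures.
From mathcomp Require Import all_boot all_order all_algebra.
From mathcomp Require Import all_classical all_reals all_analysis.
From mathcomp Require Import ring lra.
Set Implicit Arguments.
Unset Strict Implicit.
Unset Printing Implicit Defensive.

Import Order.TTheory GRing.Theory Num.Theory.
Import numFieldNormedType.Exports.
Local Open Scope classical_set_scope.
Local Open Scope ring_scope.

HB.mixin Record isTopologicalGroup G of Topological G & Group G := {
  mulg_continuous : continuous (fun p : G * G => (p.1 * p.2)%g);
  invg_continuous : continuous (fun x : G => (x^-1)%g)
}.

#[short(type="topGroupType")]
HB.structure Definition TopologicalGroup :=
  {G of Topological G & Group G & isTopologicalGroup G}.

(* The Hausdorff axiom is not listed: it follows from total disconnectedness,
   which makes points closed. *)
Definition tdlc (G : topGroupType) :=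
  totally_disconnected [set: G] /\ locally_compact [set: G].

Definition is_subgroup (G : groupType) (S : set G) :=
  S 1%g /\ forall x y, S x -> S y -> S (x / y)%g.

Record subgroup (G : groupType) := Subgroup {
  subgroup_set :> set G;
  subgroupP : is_subgroup subgroup_set
}.

(* A subgroup as a topological group of its own, with the topology induced by
   that of the ambient group. *)
Definition subgroup_type (G : groupType) (S : subgroup G) : Type :=
  set_type (subgroup_set S).

Section SubgroupType.
Variables (G : topGroupType) (S : subgroup G).

HB.instance Definition _ := SubChoice.on (subgroup_type S).

Let closedS : group_closed (fun x : G => x \in subgroup_set S).
Proof.
have [S1 SD] := subgroupP S; split; first by apply/mem_set.
by move=> x y /set_mem Sx /set_mem Sy; apply/mem_set/SD.
Qed.

HB.instance Definition _ :=
  SubChoice_isSubGroup.Build G _ (subgroup_type S) closedS.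
HB.instance Definition _ :=
  Topological.copy (subgroup_type S) (set_type (subgroup_set S)).

Let val_cont : continuous (val : subgroup_type S -> G).
Proof. exact: initial_continuous. Qed.

Let mul_cont :
  continuous (fun p : subgroup_type S * subgroup_type S => (p.1 * p.2)%g).
Proof.
apply: continuous_comp_initial => p.
apply: (@continuous_comp _ _ _
  (fun p : subgroup_type S * subgroup_type S => (val p.1, val p.2))
  (fun q : G * G => (q.1 * q.2)%g)); last exact: mulg_continuous.
apply: cvg_pair; apply: (cvg_comp _ val) (@val_cont _).
  exact: cvg_fst.
exact: cvg_snd.
Qed.

Let inv_cont : continuous (fun x : subgroup_type S => (x^-1)%g).
Proof.
apply: continuous_comp_initial => x.
apply: (@continuous_comp _ _ _ (val : subgroup_type S -> G)
  (fun y : G => (y^-1)%g)); [exact: val_cont | exact: invg_continuous].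
Qed.

HB.instance Definition _ :=
  isTopologicalGroup.Build (subgroup_type S) mul_cont inv_cont.

End SubgroupType.

Definition to_subgroup (G : groupType) (S : subgroup G) (g : G) (Sg : subgroup_set S g) :
  subgroup_type S := SigSub (mem_set Sg).

Section ScaleModular.
Variable G : topGroupType.

Definition compact_open_subgroup (U : set G) :=
  [/\ is_subgroup U, compact U & open U].

Definition left_translate (g : G) (U : set G) : set G :=
  [set (g * u)%g | u in U].

Definition right_translate (U : set G) (g : G) : set G :=
  [set (u * g)%g | u in U].

(* [g U g^-1]; beware that MathComp's [x ^ g] is [g^-1 * x * g]. *)
Definition conjugate (g : G) (U : set G) : set G :=
  [set (g * u / g)%g | u in U].

Definition has_index (A B : set G) (n : nat) :=
  ([set left_translate a B | a in A] #= `I_n)%card.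

(* Restricting to finite indices loses nothing: [U] meets its conjugate in an open
   subgroup of a compact group. *)
Definition scale_values (g : G) : set nat :=
  [set n | exists2 U, compact_open_subgroup U &
             has_index (conjugate g U) (U `&` conjugate g U) n].

Definition scale (g : G) : nat :=
  get [set n | scale_values g n /\
               forall m, scale_values g m -> (n <= m)%N].

(* MathComp's measurable types are pointed: we point a group at its unit. *)
Definition pointed_group : Type := G.
HB.instance Definition _ := Choice.on pointed_group.
HB.instance Definition _ := isPointed.Build pointed_group (1%g : G).

Definition borel_type : Type :=
  g_sigma_algebraType (@open G : set (set pointed_group)).
HB.instance Definition _ := Measurable.on borel_type.

Definition right_haar (R : realType) (mu : {measure set borel_type -> \bar R}) :=
  [/\ mu [set: G] != 0%E,
      (forall K : set G, compact K -> (mu K < +oo)%E),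
      (forall A : set G, measurable (A : set borel_type) ->
        mu A = ereal_inf [set mu O | O in [set O : set G | open O /\ A `<=` O]]),
      (forall O : set G, open O ->
        mu O = ereal_sup [set mu K | K in [set K : set G | compact K /\ K `<=` O]]) &
      (forall (A : set G) (g : G), measurable (A : set borel_type) ->
        mu (right_translate A g) = mu A)].

(* For a totally disconnected, locally compact group the set below is a singleton:
   compact open subgroups and Haar measures exist, the latter are unique up to a
   factor, and [mu (g U) / mu U] does not depend on [U]. *)
Definition modular (R : realType) (g : G) : R :=
  get [set r | exists (mu : {measure set borel_type -> \bar R}) (U : set G),
         [/\ right_haar mu, compact_open_subgroup U &
             r = fine (mu (left_translate g U)) / fine (mu U)]].

End ScaleModular.

Section NPC.
Variables (R : realType) (X : metricType R).

Definition isometric_on (I : interval R) (c : R -> X) :=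
  {in I &, forall s t, mdist (c s) (c t) = `|s - t|}.

(* Only the restriction of [c] to [[0, mdist x y]] matters. *)
Definition geodesic (c : R -> X) (x y : X) :=
  [/\ c 0 = x, c (mdist x y) = y & isometric_on `[0, mdist x y] c].

Definition geodesic_space := forall x y : X, exists c, geodesic c x y.

Definition segment (x y : X) (S : set X) :=
  exists2 c, geodesic c x y & S = c @` [set` `[0, mdist x y]].

Definition complete_space :=
  forall F : set_system X, ProperFilter F -> cauchy F -> exists x : X, F --> x.

Definition proper_space :=
  forall (x : X) (r : R), compact [set y | mdist x y <= r].

Definition edist (p q : R * R) : R :=
  Num.sqrt ((p.1 - q.1) ^+ 2 + (p.2 - q.2) ^+ 2).

(* [p' q' r'] is a comparison triangle, [x'] and [y'] are the comparison points of
   [x] and [y].  Two points on distinct sides lie on sides with a common vertex,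
   here [p]; for two points on the same side the inequality is an equality. *)
Definition cat0 :=
  forall (p q r x y : X) (A B : set X) (p' q' r' x' y' : R * R),
    segment p q A -> segment p r B -> A x -> B y ->
    edist p' q' = mdist p q -> edist p' r' = mdist p r ->
    edist q' r' = mdist q r ->
    edist p' x' = mdist p x -> edist x' q' = mdist x q ->
    edist p' y' = mdist p y -> edist y' r' = mdist y r ->
    mdist x y <= edist x' y'.

(* The point is on the side [A]; since [segment] is symmetric in its end points,
   relabelling the vertices covers the other two sides. *)
Definition hyperbolic_space (delta : R) :=
  forall (x y z : X) (A B C : set X),
    segment x y A -> segment y z B -> segment x z C ->
    forall p, A p -> exists2 q, (B `|` C) q & mdist p q <= delta.

End NPC.

(* The two kinds of NPC spaces: hyperbolic isometries and convergence to the
   boundary are defined differently in the two cases. *)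
Inductive npc_kind := CAT0 | Gromov.

Definition npc_space (k : npc_kind) (R : realType) (X : metricType R) :=
  geodesic_space X /\
  match k with
  | CAT0 => complete_space X /\ cat0 X
  | Gromov => proper_space X /\ exists2 delta, 0 <= delta & hyperbolic_space X delta
  end.

Section Boundary.
Variables (R : realType) (X : metricType R).

(* Only the restriction of a ray to the nonnegative reals matters; two rays with
   the same restriction are asymptotic. *)
Definition ray (c : R -> X) := isometric_on `[0, +oo[ c.

Definition asymptotic (c c' : R -> X) :=
  exists M, forall t, 0 <= t -> mdist (c t) (c' t) <= M.

Record boundary := Boundary {
  rays : set (R -> X);
  boundaryP : exists2 c, ray c & rays = [set c' | ray c' /\ asymptotic c c']
}.

Definition gromov_product (o x y : X) : R :=
  (mdist o x + mdist o y - mdist x y) / 2.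

(* [CAT0]: for every base point, the sequence eventually enters each basic
   neighbourhood [{y | d(o,y) > r, d([o,y](r), c(r)) < e}] of the class of the
   ray [c] from [o] in the cone topology.  [Gromov]: the Gromov products of [u n]
   with the points of any ray in the class tend to infinity. *)
Definition tends_to (k : npc_kind) (u : nat -> X) (xi : boundary) :=
  match k with
  | CAT0 => forall o : X, exists2 c, rays xi c /\ c 0 = o &
      forall r e : R, 0 < r -> 0 < e -> exists N : nat, forall n, (N <= n)%N ->
        r < mdist o (u n) /\
        forall b, geodesic b o (u n) -> mdist (b r) (c r) < e
  | Gromov => forall (o : X) c, rays xi c ->
      forall M : R, exists (N : nat) (T : R), forall n t, (N <= n)%N -> T <= t ->
        M <= gromov_product o (u n) (c t)
  end.

Lemma mdist_sym (x y : X) : mdist x y = mdist y x.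
Proof. exact: metric_sym. Qed.

Lemma mdist_triangle (y x z : X) : mdist x z <= mdist x y + mdist y z.
Proof. exact: metric_triangle. Qed.

Lemma asymptotic_refl c : asymptotic c c.
Proof. by exists 0 => t _; rewrite mdistxx. Qed.

Lemma asymptotic_sym c c' : asymptotic c c' -> asymptotic c' c.
Proof. by case=> M H; exists M => t /H; rewrite mdist_sym. Qed.

Lemma asymptotic_trans c1 c2 c3 :
  asymptotic c1 c2 -> asymptotic c2 c3 -> asymptotic c1 c3.
Proof.
move=> [M H] [M' H']; exists (M + M') => t t0.
by rewrite (le_trans (mdist_triangle (c2 t) _ _))// lerD ?H ?H'.
Qed.

Lemma boundary_ext (xi eta : boundary) :
  (rays xi = rays eta) -> xi = eta.
Proof.
case: xi eta => [A hA] [B hB] /= AB; subst B.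
by congr Boundary; exact: Prop_irrelevance.
Qed.

Lemma boundary_nonempty (xi : boundary) : exists2 c, rays xi c & ray c.
Proof.
case: (boundaryP xi) => c rc ->; exists c => //=; split => //.
exact: asymptotic_refl.
Qed.

Lemma boundary_ray (xi : boundary) c : rays xi c -> ray c.
Proof. by case: (boundaryP xi) => c0 _ -> []. Qed.

Lemma boundary_asymptotic (xi : boundary) c c' :
  rays xi c -> ray c' -> asymptotic c c' -> rays xi c'.
Proof.
case: (boundaryP xi) => c0 _ -> /= [_ cc0] rc' cc'; split => //.
exact: asymptotic_trans cc0 cc'.
Qed.

Lemma boundary_asymptotic2 (xi : boundary) c c' :
  rays xi c -> rays xi c' -> asymptotic c c'.
Proof.
case: (boundaryP xi) => c0 _ -> /= [_ h] [_ h'].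
exact: asymptotic_trans (asymptotic_sym h) h'.
Qed.

Lemma boundary_eq (xi eta : boundary) c c' :
  rays xi c -> rays eta c' -> asymptotic c c' -> xi = eta.
Proof.
move=> xc ec cc'; apply/boundary_ext/seteqP; split => b Hb.
- apply: (boundary_asymptotic ec); first exact: boundary_ray Hb.
  exact: asymptotic_trans (asymptotic_sym cc') (boundary_asymptotic2 xc Hb).
- apply: (boundary_asymptotic xc); first exact: boundary_ray Hb.
  exact: asymptotic_trans cc' (boundary_asymptotic2 ec Hb).
Qed.

End Boundary.

Section LimitUnique.
Variables (R : realType) (X : metricType R).
Implicit Types (x y z o : X) (c : R -> X).

Lemma geodesic_dist0 c x y t : geodesic c x y -> 0 <= t -> t <= mdist x y ->
  mdist x (c t) = t.
Proof.
case=> c0 _ ci t0 td; rewrite -{1}c0 ci ?in_itv/= ?lexx ?mdist_ge0 ?t0//.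
by rewrite sub0r normrN ger0_norm.
Qed.

Lemma geodesic_dist1 c x y t : geodesic c x y -> 0 <= t -> t <= mdist x y ->
  mdist (c t) y = mdist x y - t.
Proof.
case=> _ c1 ci t0 td; rewrite -{1}c1 ci ?in_itv/= ?lexx ?mdist_ge0 ?t0//.
by rewrite distrC ger0_norm ?subr_ge0.
Qed.

Lemma geodesic_rev c x y : geodesic c x y ->
  geodesic (fun t => c (mdist x y - t)) y x.
Proof.
move=> [c0 c1 ci]; rewrite /geodesic (mdist_sym y x); split.
- by rewrite subr0.
- by rewrite subrr.
- move=> s t; rewrite !in_itv/= => /andP[s0 s1] /andP[t0 t1].
  rewrite ci ?in_itv/= ?subr_ge0 ?s1 ?t1 ?gerBl ?s0 ?t0//.
  by rewrite distrC; congr `|_|; ring.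
Qed.

Lemma segmentI c x y : geodesic c x y ->
  segment x y (c @` [set` `[0, mdist x y]]).
Proof. by exists c. Qed.

Lemma segment_sym x y (S : set X) : segment x y S -> segment y x S.
Proof.
move=> [c gc ->]; exists (fun t => c (mdist x y - t)); first exact: geodesic_rev.
rewrite (mdist_sym y x); apply/seteqP; split => _ [t /= + <-];
  rewrite in_itv/= => /andP[t0 t1]; exists (mdist x y - t) => /=.
- by rewrite in_itv/= subr_ge0 t1 gerBl.
- by congr c; ring.
- by rewrite in_itv/= subr_ge0 t1 gerBl.
- by [].
Qed.

Lemma ray_geodesic c t : ray c -> 0 <= t -> geodesic c (c 0) (c t).
Proof.
move=> rc t0.
have d : mdist (c 0) (c t) = t.
  by rewrite rc ?in_itv/= ?lexx ?t0// sub0r normrN ger0_norm.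
rewrite /geodesic d; split => // r s; rewrite !in_itv/= => /andP[r0 _] /andP[s0 _].
by rewrite rc ?in_itv/= ?r0 ?s0.
Qed.

Section Thin.
Variable (delta : R).
Hypotheses (gX : geodesic_space X) (dX : hyperbolic_space X delta).

Lemma thin_close o x y a b t : geodesic a o x -> geodesic b o y -> 0 <= t ->
  t + delta < gromov_product o x y -> mdist (a t) (b t) <= delta + delta.
Proof.
move=> ga gb t0; rewrite /gromov_product => tg.
have tx := mdist_triangle x o y; have ty := mdist_triangle y o x.
rewrite (mdist_sym y x) in ty.
have [c gc] := gX x y.
have [tdx tdy] : t <= mdist o x /\ t <= mdist o y.
  suff : 0 <= delta by move=> ?; split; lra.
  have oA : (a @` [set` `[0, mdist o x]]) (a 0).
    by exists 0 => //=; rewrite in_itv/= lexx mdist_ge0.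
  have [q _] := dX (segmentI ga) (segmentI gc) (segmentI gb) oA.
  exact/le_trans/mdist_ge0.
have pA : (a @` [set` `[0, mdist o x]]) (a t).
  by exists t => //=; rewrite in_itv/= t0.
have [q [] [s /=]] := dX (segmentI ga) (segmentI gc) (segmentI gb) pA.
- rewrite in_itv/= => /andP[s0 s1] <- pq.
  have := geodesic_dist0 ga t0 tdx.
  have := geodesic_dist0 gc s0 s1; have := geodesic_dist1 gc s0 s1.
  have := mdist_triangle (a t) o (c s).
  have := mdist_triangle (c s) o x; have := mdist_triangle (c s) o y.
  rewrite (mdist_sym (c s) x); lra.
- rewrite in_itv/= => /andP[s0 s1] <- pq.
  have e1 := geodesic_dist0 ga t0 tdx; have e2 := geodesic_dist0 gb s0 s1.
  have := mdist_triangle (a t) o (b s); have := mdist_triangle (b s) o (a t).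
  rewrite e1 e2 (mdist_sym (b s)) => h1 h2.
  apply: (le_trans (mdist_triangle (b s) _ _)); apply: lerD => //.
  case: gb => _ _ ->; rewrite ?in_itv/= ?s0 ?s1 ?t0 ?tdy//.
  rewrite ler_norml; lra.
Qed.

Lemma thin_base o o' x a b t : geodesic a o x -> geodesic b o' x -> 0 <= t ->
  t <= mdist o x -> t <= mdist o' x ->
  mdist (a t) (b t) <= 2 * delta + 3 * mdist o o'.
Proof.
move=> ga gb t0 tx tx'; have [c gc] := gX o o'.
have D0 := mdist_ge0 o o'.
have e1 := geodesic_dist0 ga t0 tx; have e1' := geodesic_dist0 gb t0 tx'.
have pA : (a @` [set` `[0, mdist o x]]) (a t).
  by exists t => //=; rewrite in_itv/= t0.
have [q [] [s /=]] := dX (segmentI ga) (segment_sym (segmentI gb)) (segmentI gc) pA.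
- rewrite in_itv/= => /andP[s0 s1] <- pq.
  have e2 := geodesic_dist0 gb s0 s1.
  have := mdist_triangle o o' (b s); have := mdist_triangle (a t) o (b s).
  have := mdist_triangle o' o (a t); have := mdist_triangle (b s) o' (a t).
  rewrite e1 e2 (mdist_sym o' o) (mdist_sym (b s)) => h1 h2 h3 h4.
  apply: (le_trans (mdist_triangle (b s) _ _)).
  have : mdist (b s) (b t) <= delta + mdist o o'; last by lra.
  case: gb => _ _ ->; rewrite ?in_itv/= ?s0 ?s1 ?t0 ?tx'//.
  rewrite ler_norml; lra.
- rewrite in_itv/= => /andP[s0 s1] <- pq.
  have e2 := geodesic_dist0 gc s0 s1.
  have := mdist_triangle (c s) o (a t); have := mdist_triangle o (a t) (b t).
  have := mdist_triangle o' o (b t).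
  rewrite e1 e1' e2 (mdist_sym (a t) o) e1 (mdist_sym (c s)); lra.
Qed.

End Thin.

Lemma tends_to_unique k (u : nat -> X) (xi eta : boundary X) :
  npc_space k X -> tends_to k u xi -> tends_to k u eta -> xi = eta.
Proof.
case: k => /= -[gX].
- move=> _ h h'; have [c0 _ _] := boundary_nonempty xi.
  have [c [xc cE] H] := h (c0 0); have [c' [ec cE'] H'] := h' (c0 0).
  apply: (boundary_eq xc ec); exists 0 => t; rewrite le_eqVlt => /orP[/eqP<-|t0].
    by rewrite cE cE' mdistxx.
  apply/ler_addgt0Pr => e e0; rewrite add0r.
  have e20 : 0 < e / 2 by rewrite divr_gt0.
  have [N HN] := H _ _ t0 e20; have [N' HN'] := H' _ _ t0 e20.
  have [_ A] := HN (maxn N N') (leq_maxl _ _).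
  have [_ A'] := HN' (maxn N N') (leq_maxr _ _).
  have [b gb] := gX (c0 0) (u (maxn N N')).
  have := A _ gb; have := A' _ gb; have := mdist_triangle (b t) (c t) (c' t).
  by rewrite (mdist_sym (c t) (b t)); lra.
- move=> [_ [delta d0 dX]] h h'.
  have [c xc rc] := boundary_nonempty xi; have [c' ec rc'] := boundary_nonempty eta.
  apply: (boundary_eq xc ec).
  exists (6 * delta + 3 * mdist (c 0) (c' 0)) => t t0.
  have [N [T H]] := h (c 0) c xc (t + delta + 1).
  have [N' [T' H']] := h' (c' 0) c' ec (t + delta + 1).
  pose n := maxn N N'; pose m := Num.max 0 (Num.max T T').
  have m0 : 0 <= m by rewrite le_max lexx.
  have {}H := H n m (leq_maxl _ _).
  have {}H' := H' n m (leq_maxr _ _).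
  have {}H : t + delta + 1 <= gromov_product (c 0) (u n) (c m).
    by apply: H; rewrite !le_max lexx !orbT.
  have {}H' : t + delta + 1 <= gromov_product (c' 0) (u n) (c' m).
    by apply: H'; rewrite !le_max lexx !orbT.
  have [a ga] := gX (c 0) (u n); have [b gb] := gX (c' 0) (u n).
  have A : mdist (a t) (c t) <= delta + delta.
    by apply: (thin_close gX dX ga (ray_geodesic rc m0)) => //; lra.
  have B : mdist (b t) (c' t) <= delta + delta.
    by apply: (thin_close gX dX gb (ray_geodesic rc' m0)) => //; lra.
  have C : mdist (a t) (b t) <= 2 * delta + 3 * mdist (c 0) (c' 0).
    apply: (thin_base gX dX ga gb t0).
    + have := mdist_triangle (u n) (c 0) (c m); move: H; rewrite /gromov_product; lra.
    + have := mdist_triangle (u n) (c' 0) (c' m); move: H'; rewrite /gromov_product; lra.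
  have := mdist_triangle (a t) (c t) (c' t); have := mdist_triangle (b t) (a t) (c' t).
  by rewrite (mdist_sym (c t) (a t)); lra.
Qed.

Lemma tends_to_shift k (u : nat -> X) (xi : boundary X) :
  tends_to k u xi -> tends_to k (fun n => u n.+1) xi.
Proof.
case: k => /= h o.
- have [c xc H] := h o; exists c => // r e r0 e0.
  have [N HN] := H r e r0 e0; exists N => n Nn; apply: HN; exact: leqW.
- move=> c xc M; have [N [T H]] := h o c xc M.
  exists N, T => n t Nn Tt; apply: H => //; exact: leqW.
Qed.

End LimitUnique.

Record isometric_action (G : groupType) (R : realType) (X : metricType R) :=
  IsometricAction {
    act :> G -> X -> X;
    act1 : forall x, act 1%g x = x;
    actM : forall g h x, act (g * h)%g x = act g (act h x);
    act_isometry : forall g x y, mdist (act g x) (act g y) = mdist x y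
  }.

Section BoundaryAction.
Variables (G : groupType) (R : realType) (X : metricType R).
Variable a : isometric_action G X.

Lemma actK g x : a g^-1%g (a g x) = x.
Proof. by rewrite -actM mulVg act1. Qed.

Lemma actKV g x : a g (a g^-1%g x) = x.
Proof. by rewrite -actM mulgV act1. Qed.

Lemma act_ray g c : ray c -> ray (a g \o c).
Proof. by move=> rc s t s0 t0; rewrite /= act_isometry rc. Qed.

Lemma act_asymptotic g c c' : asymptotic c c' -> asymptotic (a g \o c) (a g \o c').
Proof. by move=> [M H]; exists M => t t0; rewrite /= act_isometry H. Qed.

Lemma boundary_act_subproof g (xi : boundary X) :
  exists2 c, ray c &
    [set a g \o c | c in rays xi] = [set c' | ray c' /\ asymptotic c c'].
Proof.
case: (boundaryP xi) => c rc ->; exists (a g \o c); first exact: act_ray.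
apply/seteqP; split => [_ [b [rb cb] <-]|b [rb cb]] /=.
  by split; [exact: act_ray | exact: act_asymptotic].
exists (a g^-1%g \o b); last by apply/funext => t /=; rewrite actKV.
split; first exact: act_ray.
have := act_asymptotic g^-1 cb.
by congr asymptotic; apply/funext => t /=; rewrite actK.
Qed.

Definition boundary_act (g : G) (xi : boundary X) : boundary X :=
  Boundary (boundary_act_subproof g xi).

Lemma boundary_act1 xi : boundary_act 1 xi = xi.
Proof.
apply/boundary_ext/seteqP; split => [_ [c xc <-]|c xc] /=.
  by rewrite (_ : _ \o _ = c)//; apply/funext => t /=; rewrite act1.
by exists c => //; apply/funext => t /=; rewrite act1.
Qed.

Lemma boundary_actM g h xi :
  boundary_act (g * h) xi = boundary_act g (boundary_act h xi).
Proof.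
apply/boundary_ext/seteqP; split => [_ [c xc <-]|_ [_ [c xc <-] <-]] /=.
  exists (a h \o c); first by exists c.
  by apply/funext => t /=; rewrite actM.
by exists c => //; apply/funext => t /=; rewrite actM.
Qed.

Definition stabilizer_set (xi : boundary X) : set G :=
  [set g | boundary_act g xi = xi].

Lemma stabilizer_subproof xi : is_subgroup (stabilizer_set xi).
Proof.
split=> [|g h gx hx]; rewrite /stabilizer_set/=; first exact: boundary_act1.
have hVx : boundary_act h^-1 xi = xi.
  by rewrite -{1}hx -boundary_actM mulVg boundary_act1.
by rewrite boundary_actM hVx.
Qed.

Definition stabilizer (xi : boundary X) : subgroup G :=
  Subgroup (stabilizer_subproof xi).

Definition expgz (g : G) (m : int) : G :=
  match m with
  | Posz n => (g ^+ n)%g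
  | Negz n => (g ^- n.+1)%g
  end.

Definition has_axis (g : G) :=
  exists (c : R -> X) (l : R),
    [/\ isometric_on `]-oo, +oo[ c, 0 < l & forall t, a g (c t) = c (t + l)].

Definition orbit_quasi_isometric (g : G) (x : X) :=
  exists L C : R, [/\ 1 <= L, 0 <= C &
    forall m n : int,
      L^-1 * `|m - n|%:~R - C <= mdist (a (expgz g m) x) (a (expgz g n) x) /\
      mdist (a (expgz g m) x) (a (expgz g n) x) <= L * `|m - n|%:~R + C].

Definition hyperbolic (k : npc_kind) (g : G) :=
  match k with
  | CAT0 => has_axis g
  | Gromov => exists x, orbit_quasi_isometric g x
  end.

Definition attracting (k : npc_kind) (g : G) (xi : boundary X) :=
  forall x, tends_to k (fun n => a (g ^+ n)%g x) xi.

Definition repelling (k : npc_kind) (g : G) (xi : boundary X) :=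
  attracting k g^-1%g xi.

Definition hyperbolic_limits (k : npc_kind) : set (boundary X) :=
  [set xi | exists2 g, hyperbolic k g & attracting k g xi \/ repelling k g xi].

(* The relation [xi1 -> xi2] on [hyperbolic_limits k]. *)
Definition arrow (k : npc_kind) (xi1 xi2 : boundary X) :=
  [/\ hyperbolic_limits k xi1, hyperbolic_limits k xi2 &
      forall h, hyperbolic k h -> attracting k h xi1 -> repelling k h xi2].

Lemma act_geodesic g c x y : geodesic c x y -> geodesic (a g \o c) (a g x) (a g y).
Proof.
rewrite /geodesic act_isometry /= => -[-> -> ci]; split => // s t s0 t0.
by rewrite /= act_isometry ci.
Qed.

Lemma tends_to_act k g (u : nat -> X) xi :
  tends_to k u xi -> tends_to k (fun n => a g (u n)) (boundary_act g xi).
Proof.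
have dE o x : mdist o (a g x) = mdist (a g^-1%g o) x.
  by rewrite -(act_isometry a g (a g^-1%g o)) actKV.
have dE' o x : mdist (a g x) o = mdist x (a g^-1%g o).
  by rewrite mdist_sym dE mdist_sym.
case: k => /= h o.
- have [c [xc c0] H] := h (a g^-1%g o); exists (a g \o c).
    by split; [exists c | rewrite /= c0 actKV].
  move=> r e r0 e0; have [N HN] := H r e r0 e0; exists N => n /HN[h1 h2].
  rewrite dE; split => // b gb; rewrite /= mdist_sym dE' mdist_sym.
  by apply: (h2 (a g^-1%g \o b)); rewrite -[u n](actK g); exact: act_geodesic.
- move=> _ [c xc <-] M; have [N [T H]] := h (a g^-1%g o) c xc M.
  exists N, T => n t Nn Tt; have := H n t Nn Tt.
  by rewrite /gromov_product /= !dE actK.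
Qed.

Lemma attracting_stabilizer k g xi :
  npc_space k X -> attracting k g xi -> subgroup_set (stabilizer xi) g.
Proof.
move=> kX gxi; have [c _ _] := boundary_nonempty xi.
apply: (tends_to_unique kX (tends_to_act g (gxi (c 0)))).
have := tends_to_shift (gxi (c 0)).
by congr tends_to; apply/funext => n; rewrite expgS actM.
Qed.

End BoundaryAction.

Definition continuous_action (G : topGroupType) (R : realType) (X : metricType R)
    (a : isometric_action G X) :=
  continuous (fun p : G * X => a p.1 p.2).

Definition proper_action (G : topGroupType) (R : realType) (X : metricType R)
    (a : isometric_action G X) :=
  forall (x : X) (r : R), 0 < r -> compact (closure [set g | mdist (a g x) x <= r]).

(* Main.v *)
(* Write [al h = g h g^-1].  If [h] fixes the endpoint of an orbit [g^n x] then it displaces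
   this orbit by at most a constant that depends on the displacement of [x] only, and
   conversely an element of bounded displacement along the orbit fixes its endpoint.
   Hence the stabilizer of the repelling point [xi-] consists of the [h] with relatively
   compact forward orbit [al^n h], and it contains every compact open [U] with [al U]
   inside [U], that is, it is open if the scale is one.  Conversely, if the stabilizer is open
   then the forward orbit of some compact open subgroup is relatively compact, and tidying
   (Willis) produces a compact open subgroup that [al] maps into itself.  The same
   equivalence inside the stabilizer of [xi+], where [xi+] is repelling for [g^-1] and hence
   [g^-1] has scale one, settles the statements on that group: the modular function at [g]
   is the index of [U] in [g U g^-1] for a suitable [U].  Tidy subgroups are products
   [V_+ V_-] with [V_+] fixing [xi+] and [V_-] fixing [xi-], so the stabilizer of [xi-] is
   open as soon as it contains that of [xi+]; and if it meets the latter in an open subgroup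
   then it contains it, by comparing conjugates [g^-n h g^n] in a common coset. *)
Require Import Defs.
From HB Require Import structures.
From mathcomp Require Import all_boot all_order all_algebra.
From mathcomp Require Import all_classical all_reals all_analysis.
From mathcomp Require Import ring lra.
Set Implicit Arguments.
Unset Strict Implicit.
Unset Printing Implicit Defensive.
Import Order.TTheory GRing.Theory Num.Theory.
Import numFieldNormedType.Exports.
Local Open Scope classical_set_scope.
Local Open Scope ring_scope.

(** * Gromov hyperbolic spaces *)

(** The two kinds of spaces reach the group theory through common facts: asymptotic rays fellow
    travel with a bound that depends on their origins alone, the forward orbit of a hyperbolic
    element escapes along a ray of its attracting point, and convergence to the boundary survives
    bounded perturbation. Constants are crude, as only boundedness matters. On the group side,
    [scale] and [modular] are picked by [get] and have a meaning only if a minimum or a Haar measure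
    exists. For the scale, the value one is characterized by a compact open subgroup that contains
    its conjugate. For the modular function a Haar measure is constructed; compact open subgroups
    reduce this to counting cosets. The stabilizer of [xip] is handled as an acting group in its own
    right, which requires it to be closed: then it inherits properness of the action and a basis of
    compact open subgroups. *)

Section GromovProduct.
Variables (R : realType) (X : metricType R) (delta : R).
Hypotheses (gX : geodesic_space X) (dX : hyperbolic_space X delta) (d0 : 0 <= delta).
Implicit Types (o x y z p q : X).

Lemma gromov_product_ge0 o x y : 0 <= gromov_product o x y.
Proof.
rewrite /gromov_product; have := mdist_triangle o x y.
by rewrite (mdist_sym x o); lra.
Qed.

Lemma gromov_productC o x y : gromov_product o x y = gromov_product o y x.
Proof. by rewrite /gromov_product (mdist_sym x y); congr (_ / _); ring. Qed.

Lemma gromov_product_compl o x y :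
  gromov_product x o y = mdist x o - gromov_product o x y.
Proof. by rewrite /gromov_product (mdist_sym x o); lra. Qed.

Lemma four_point o x y z :
  gromov_product o x y - (3 * delta + 1) <= gromov_product o x z \/
  gromov_product o y z - (3 * delta + 1) <= gromov_product o x z.
Proof.
pose M := Num.min (gromov_product o x y) (gromov_product o y z).
suff : M - (3 * delta + 1) <= gromov_product o x z.
  by rewrite /M minEle; case: ifP => _; [left|right].
have Mx : M <= gromov_product o x y by rewrite /M ge_min lexx.
have Mz : M <= gromov_product o y z by rewrite /M ge_min lexx orbT.
have g0 := gromov_product_ge0 o x z; clearbody M.
have d1 := d0; have [Md|dM] := leP M (delta + 1); first lra.
have [ax gax] := gX o x; have [ay gay] := gX o y; have [az gaz] := gX o z.
have xy := thin_close gX dX (t := M - delta - 1) gax gay.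
have yz := thin_close gX dX (t := M - delta - 1) gay gaz.
have {}xy : mdist (ax (M - delta - 1)) (ay (M - delta - 1)) <= delta + delta.
  by apply: xy; lra.
have {}yz : mdist (ay (M - delta - 1)) (az (M - delta - 1)) <= delta + delta.
  by apply: yz; lra.
have ltx : M - delta - 1 <= mdist o x.
  move: Mx; rewrite /gromov_product; have := mdist_triangle x o y; lra.
have ltz : M - delta - 1 <= mdist o z.
  move: Mz; rewrite /gromov_product; have := mdist_triangle z o y.
  rewrite (mdist_sym z y); lra.
have tM : 0 <= M - delta - 1 by lra.
have := geodesic_dist1 gax tM ltx; have := geodesic_dist1 gaz tM ltz.
set u := ax _ in xy *; set v := ay _ in xy yz *; set w := az _ in yz *.
have := mdist_triangle u x z; have := mdist_triangle w u z; have := mdist_triangle v u w.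
rewrite (mdist_sym x u) /gromov_product; lra.
Qed.

(** The geodesics from [p] to [z] and to [q] are within [2 * delta] of each other until shortly
    before the time [(z|q)_p], when the first one is at distance [(p|q)_z + delta + 1] from [z]. *)
Lemma near_geodesic b p q z : geodesic b p q ->
  exists2 s, 0 <= s & mdist z (b s) <= gromov_product z p q + 3 * delta + 1.
Proof.
move=> gb; have d1 := d0; have := gromov_product_compl z p q;
  have := gromov_product_compl p z q.
have [gl|gl] := leP (gromov_product p z q) (delta + 1).
  move=> E1 E2; exists 0 => //; have [-> _ _] := gb.
  by rewrite E1; lra.
have [az ga] := gX p z => E1 E2.
exists (gromov_product p z q - delta - 1); first by lra.
set s := _ - _ - _.
have h : mdist (az s) (b s) <= delta + delta.
  by apply: (thin_close gX dX ga gb); rewrite /s; lra.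
have s0 : 0 <= s by rewrite /s; lra.
have s1 : s <= mdist p z.
  rewrite /s /gromov_product; have := mdist_triangle z p q; lra.
have := geodesic_dist1 ga s0 s1; have := mdist_triangle (az s) z (b s).
by move: E1 E2; rewrite (mdist_sym z (az s)) /s (mdist_sym z p); lra.
Qed.

Section LocalToGlobal.
Variables (y : nat -> X) (b : R).
Let e := 3 * delta + 1.
Hypothesis ya : forall i, gromov_product (y i.+1) (y i) (y i.+2) <= b.
Hypothesis yL : forall i, 2 * b + 3 * e + 1 <= mdist (y i) (y i.+1).

(** Induction along a broken geodesic with long pieces. Of the two cases of the four-point
    inequality at the new corner, one is excluded because the last piece is long and the previous
    product small, so that [y 0] and the previous corner have a large product; the other is the
    claim. *)
Lemma local_to_global_last n : gromov_product (y n.+1) (y 0%N) (y n.+2) <= b + e.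
Proof.
have e0 : 0 <= e by have := d0; rewrite /e; lra.
elim: n => [|n IH]; first by have := ya 0; lra.
have := gromov_product_compl (y n.+1) (y n.+2) (y 0%N).
rewrite gromov_productC (gromov_productC (y n.+1)).
have := ya n.+1; have := yL n.+1; rewrite (mdist_sym (y n.+1)).
by case: (four_point (y n.+2) (y n.+1) (y 0%N) (y n.+3));
  rewrite -/e ?(gromov_productC _ (y n.+1) (y 0%N)); lra.
Qed.

Lemma local_to_global_first n i :
  gromov_product (y i.+1) (y i) (y (i + n.+2)%N) <= b + e.
Proof.
have e0 : 0 <= e by have := d0; rewrite /e; lra.
elim: n i => [|n IH] i; first by rewrite addn2; have := ya i; lra.
have := IH i.+1; rewrite addSnnS => h.
have := gromov_product_compl (y i.+2) (y i.+1) (y (i + n.+3)%N).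
have := ya i; have := yL i.+1.
case: (four_point (y i.+1) (y i) (y (i + n.+3)%N) (y i.+2));
  rewrite -/e ?(gromov_productC _ (y (i + n.+3)%N) (y i.+2)); lra.
Qed.

(** The point [y k.+2] mediates between the two one-sided bounds. The product to be excluded is now
    compared with [b + e] instead of [b], whence [3 * e] in [yL]. *)
Lemma local_to_global k n :
  gromov_product (y k.+1) (y 0%N) (y (k.+2 + n)%N) <= b + 2 * e.
Proof.
have e0 : 0 <= e by have := d0; rewrite /e; lra.
have h := local_to_global_last k.
case: n => [|n]; first by rewrite addn0; lra.
have := local_to_global_first n k.+1; rewrite -addSnnS => h'.
have := gromov_product_compl (y k.+2) (y k.+1) (y (k.+2 + n.+1)%N).
have := yL k.+1.
by case: (four_point (y k.+1) (y 0%N) (y (k.+2 + n.+1)%N) (y k.+2));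
  rewrite -/e ?(gromov_productC _ (y (k.+2 + n.+1)%N) (y k.+2)); lra.
Qed.

End LocalToGlobal.

Lemma gromov_rays_fellow_travel (c c' : R -> X) t :
  ray c -> ray c' -> asymptotic c c' -> 0 <= t ->
  mdist (c t) (c' t) <= 3 * mdist (c 0) (c' 0) + 4 * delta.
Proof.
move=> rc rc' [M HM] t0; have d1 := d0.
have M0 : 0 <= M by apply: le_trans (mdist_ge0 _ _) (HM 0 _).
(* [T] is so large that [c T] and [c' T], which are at most [M] apart, have a Gromov product above
   [t + delta] at [c' 0]. *)
pose T := t + 2 * delta + 2 * mdist (c 0) (c' 0) + M + 1.
have D0 := mdist_ge0 (c 0) (c' 0).
have T0 : 0 <= T by rewrite /T; lra.
have [u gu] := gX (c' 0) (c T).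
have gc := ray_geodesic rc T0; have gc' := ray_geodesic rc' T0.
have dc : mdist (c 0) (c T) = T.
  by rewrite rc ?in_itv/= ?lexx ?T0// sub0r normrN ger0_norm.
have dc' : mdist (c' 0) (c' T) = T.
  by rewrite rc' ?in_itv/= ?lexx ?T0// sub0r normrN ger0_norm.
have tri1 := mdist_triangle (c' 0) (c 0) (c T).
have tri2 := mdist_triangle (c T) (c' 0) (c' T).
have HT := HM _ T0.
have tT : t <= T by rewrite /T; lra.
have A : mdist (c t) (u t) <= 2 * delta + 3 * mdist (c 0) (c' 0).
  by apply: (thin_base gX dX gc gu t0); rewrite ?dc //; rewrite /T in tri1 dc *; lra.
have B : mdist (u t) (c' t) <= delta + delta.
  apply: (thin_close gX dX gu gc' t0); rewrite /gromov_product dc'.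
  by rewrite /T in tri1 dc HT *; lra.
have := mdist_triangle (u t) (c t) (c' t); lra.
Qed.

End GromovProduct.

(** If doubling [N] always added less than [B], then [f (2 ^ k)] would grow at most linearly in [k],
    against the linear lower bound on [f]. *)
Lemma doubling_gap (R : realType) (f : nat -> R) (l C B : R) :
  0 < l -> (forall n, l * n%:R - C <= f n) ->
  exists2 N, (0 < N)%N & f N + B <= f (N + N)%N.
Proof.
move=> l0 fl; apply: contrapT => H.
have {}H N : (0 < N)%N -> f (N + N)%N <= f N + `|B|.
  move=> N0; have [h|h] := leP (f N + B) (f (N + N)%N).
    by case: H; exists N.
  by have := ler_norm B; lra.
have fk k : f (2 ^ k)%N <= f 1%N + k%:R * `|B|.
  elim: k => [|k IH]; first by rewrite expn0; lra.
  rewrite expnS mul2n -addnn -natr1; have := H (2 ^ k)%N; rewrite expn_gt0 => /(_ isT).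
  by rewrite mulrDl; lra.
pose D : R := 2 * `|B| + `|C| + `|f 1%N|.
have D0 : 0 <= D by rewrite /D !addr_ge0 ?mulr_ge0.
have [j jD] : exists j : nat, D / l + 1 < j%:R.
  by exists (Num.trunc (D / l + 1)).+1; rewrite truncnS_gt.
have j1 : 1 <= j%:R :> R.
  have : 0 <= D / l by rewrite divr_ge0// ltW.
  by move=> ?; lra.
(* At [k = 2 j] the estimate [2 ^ k >= j * j] suffices to beat a bound linear in [j]. *)
have h1 := le_trans (fl _) (fk (j + j)%N).
have h2 : j%:R * j%:R <= (2 ^ (j + j))%N%:R :> R.
  by rewrite -natrM ler_nat expnD leq_mul// ltnW// ltn_expl.
have h3 : l * (j%:R * j%:R) <= l * (2 ^ (j + j))%N%:R by rewrite ler_pM2l.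
have h4 : D < l * j%:R by rewrite mulrC -ltr_pdivrMr//; lra.
have h5 : D * j%:R < l * j%:R * j%:R by rewrite ltr_pM2r//; lra.
have h6 : 2 * `|B| * j%:R + `|C| + `|f 1%N| <= D * j%:R.
  have : `|C| <= `|C| * j%:R by rewrite ler_peMr.
  have : `|f 1%N| <= `|f 1%N| * j%:R by rewrite ler_peMr.
  by rewrite /D !mulrDl; lra.
have := ler_norm C; have := ler_norm (f 1%N).
by move: h1; rewrite natrD mulrDl; lra.
Qed.

Section Orbits.
Variables (G : groupType) (R : realType) (X : metricType R) (a : isometric_action G X).
Implicit Types (g h : G) (x y : X).

Lemma orbit_shift g x m n :
  mdist (a (g ^+ m)%g x) (a (g ^+ (m + n))%g x) = mdist x (a (g ^+ n)%g x).
Proof. by rewrite expgnDr actM act_isometry. Qed.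

Lemma orbit_le g x n : mdist x (a (g ^+ n)%g x) <= n%:R * mdist x (a g x).
Proof.
elim: n => [|n IH]; first by rewrite expg0 act1 mdistxx mul0r.
have := mdist_triangle (a (g ^+ n)%g x) x (a (g ^+ n.+1)%g x).
by rewrite -addn1 orbit_shift expg1 natrD mulrDl mul1r; lra.
Qed.

Lemma orbit_basepoint h x y : mdist x (a h x) <= mdist y (a h y) + 2 * mdist x y.
Proof.
have := mdist_triangle y x (a h x); have := mdist_triangle (a h y) y (a h x).
by rewrite act_isometry (mdist_sym y x); lra.
Qed.

Lemma quasi_isometric_growth g x0 x : orbit_quasi_isometric a g x0 ->
  exists l C, 0 < l /\ forall n, l * n%:R - C <= mdist x (a (g ^+ n)%g x).
Proof.
move=> [L [C [L1 C0 H]]]; exists L^-1, (C + 2 * mdist x0 x); split.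
  by rewrite invr_gt0; lra.
move=> n; have [+ _] := H 0 (Posz n).
rewrite sub0r normrN /= expg0 act1 => h.
by have := orbit_basepoint (g ^+ n)%g x0 x; lra.
Qed.

(* [N] is chosen such that [f (2 N)] exceeds [f N] by a multiple of [delta], so the
   orbit of [g^N] has small Gromov products locally, hence globally: this replaces
   the stability of quasi-geodesics. *)
Lemma gromov_quasi_axis delta g x0 xi (c : R -> X) :
  geodesic_space X -> hyperbolic_space X delta -> 0 <= delta ->
  orbit_quasi_isometric a g x0 -> attracting a Gromov g xi -> rays xi c ->
  exists D, forall n, exists2 t, 0 <= t & mdist (a (g ^+ n)%g (c 0)) (c t) <= D.
Proof.
move=> gX dX d0 qi gxi xic; have rc := boundary_ray xic.
have [l [C [l0 growth]]] := quasi_isometric_growth (c 0) qi.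
pose e := 3 * delta + 1.
have [N N0 gap] := doubling_gap (3 * e + 1) l0 growth.
pose f n := mdist (c 0) (a (g ^+ n)%g (c 0)).
pose y i := a (g ^+ (i * N))%g (c 0).
(* [b] is the Gromov product at every corner of the broken line [y]; with this value [gap] becomes
   the length condition [yL]. *)
pose b := f N - f (N + N)%N / 2.
have yf i : mdist (y i) (y i.+1) = f N by rewrite /y mulSn addnC orbit_shift.
have yf2 i : mdist (y i) (y i.+2) = f (N + N)%N.
  by rewrite /y !mulSn addnA addnC orbit_shift.
have ya i : gromov_product (y i.+1) (y i) (y i.+2) <= b.
  by rewrite /gromov_product (mdist_sym _ (y i)) !yf yf2 /b; lra.
have yL i : 2 * b + 3 * (3 * delta + 1) + 1 <= mdist (y i) (y i.+1).
  by rewrite yf /b; rewrite -/(f _) -/(f _) /e in gap; lra.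
have yglob := local_to_global gX dX d0 ya yL.
have ynear i : exists2 t, 0 <= t & mdist (y i) (c t) <= b + 6 * e.
  case: i => [|i].
    exists 0 => //; rewrite /y mul0n expg0 act1 mdistxx.
    by have := ya 0; have := gromov_product_ge0 (y 1) (y 0) (y 2); rewrite /e; lra.
  (* Seen from [y i.+1], a far orbit point has a product above [b + 3 * e] with [c t] and at most
     [b + 2 * e] with [c 0]. Hence [c 0] and [c t] have a small product there, and the ray passes
     close to [y i.+1]. *)
  have [M [T H]] := gxi (c 0) (y i.+1) c xic (b + 2 * e + e + 1).
  pose t : R := Num.max 0 T.
  have t0 : 0 <= t by rewrite le_max lexx.
  have Tt : T <= t by rewrite le_max lexx orbT.
  have := H ((i.+2 + M) * N)%N t (leq_trans (leq_addl _ _) (leq_pmulr _ N0)) Tt.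
  have := yglob i M; rewrite -/(y (i.+2 + M)%N) -/e.
  have ey0 : y 0 = c 0 by rewrite /y mul0n expg0 act1.
  move=> h1 h2; have {h1 h2}h : gromov_product (y i.+1) (c 0) (c t) <= b + 3 * e.
    have := four_point gX dX d0 (y i.+1) (c 0) (c t) (y (i.+2 + M)%N).
    rewrite -/e; rewrite ey0 in h1.
    rewrite (gromov_productC _ (c t)); case; lra.
  have [s s0 hs] := near_geodesic gX dX d0 (y i.+1) (ray_geodesic rc t0).
  by exists s => //; move: hs; rewrite /e in h *; lra.
(* [F] absorbs the remainder of the exponent modulo [N]. *)
pose F := \sum_(i < N) f i.
exists (b + 6 * e + F) => n.
have [t t0 ht] := ynear (n %/ N)%N; exists t => //.
have : f (n %% N)%N <= F.
  rewrite /F (bigD1 (Ordinal (ltn_pmod n N0)))//= lerDl sumr_ge0// => i _.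
  exact: mdist_ge0.
have := orbit_shift g (c 0) (n %/ N * N) (n %% N); rewrite -divn_eq -/(y _) -/(f _).
by have := mdist_triangle (y (n %/ N)%N) (a (g ^+ n)%g (c 0)) (c t);
  rewrite (mdist_sym _ (y (n %/ N)%N)); lra.
Qed.

End Orbits.

(** * CAT(0) spaces *)

Section CAT0.
Variables (R : realType) (X : metricType R).
Implicit Types (c : R -> X).
Local Notation edist := Defs.edist.

Lemma edist_eq (p q : R * R) (d : R) :
  0 <= d -> (p.1 - q.1) ^+ 2 + (p.2 - q.2) ^+ 2 = d ^+ 2 -> edist p q = d.
Proof. by move=> d0; rewrite /Defs.edist => ->; rewrite sqrtr_sqr ger0_norm. Qed.

Lemma edist_sq (p q : R * R) :
  (p.1 - q.1) ^+ 2 + (p.2 - q.2) ^+ 2 = edist p q ^+ 2.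
Proof. by rewrite /Defs.edist sqr_sqrtr// addr_ge0 ?sqr_ge0. Qed.

Lemma edist_ge0 (p q : R * R) : 0 <= edist p q.
Proof. exact: sqrtr_ge0. Qed.

Lemma comparison_triangle (x y z : R) : 0 <= x -> 0 <= y -> 0 <= z ->
  x <= y + z -> y <= x + z -> z <= x + y ->
  exists q r : R * R, [/\ edist (0, 0) q = x, edist (0, 0) r = y & edist q r = z].
Proof.
move=> x0 y0 z0 xyz yxz zxy.
have [xE|xN] := eqVneq x 0.
  exists (0, 0), (y, 0); split; apply: edist_eq => //=; [rewrite xE; ring|ring|].
  have -> : z = y by apply/eqP; rewrite eq_le; apply/andP; split; lra.
  ring.
(* Law of cosines: with [q] on the first axis, [u] is the first coordinate of [r]. *)
pose u : R := (x ^+ 2 + y ^+ 2 - z ^+ 2) / (2 * x).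
have xu : x * u *+ 2 = x ^+ 2 + y ^+ 2 - z ^+ 2 by rewrite /u; field.
have {}x0 : 0 < x by rewrite lt_def xN.
have s1 : (x - y) ^+ 2 <= z ^+ 2.
  by rewrite -(ger0_norm z0) real_normK ?num_real// -ler_sqrt ?sqr_ge0// !sqrtr_sqr
    (ger0_norm z0) ler_norml; lra.
have s2 : z ^+ 2 <= (x + y) ^+ 2 by rewrite ler_sqr ?nnegrE; lra.
have uy : u <= y by rewrite -(ler_pM2l x0); move: s1; rewrite sqrrB; lra.
have yu : - y <= u by rewrite -(ler_pM2l x0); move: s2; rewrite sqrrD; lra.
have v0 : 0 <= y ^+ 2 - u ^+ 2.
  by rewrite subr_sqr mulr_ge0; lra.
exists (x, 0), (u, Num.sqrt (y ^+ 2 - u ^+ 2)).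
have sv := sqr_sqrtr v0.
split; apply: edist_eq => //=; rewrite ?(ltW x0)//; first by ring.
  rewrite !sub0r !sqrrN sv; ring.
rewrite sub0r sqrrN sv sqrrB; move: xu; lra.
Qed.

Hypothesis cX : cat0 X.

(** In a comparison triangle with [p'] at the origin, the comparison points are the images of [q']
    and [r'] under the homothety of ratio [l]. *)
Lemma cat0_dilation p q r b c (l : R) : geodesic b p q -> geodesic c p r ->
  0 <= l -> l <= 1 ->
  mdist (b (l * mdist p q)) (c (l * mdist p r)) <= l * mdist q r.
Proof.
move=> gb gc l0 l1.
have lq : l * mdist p q <= mdist p q by rewrite ler_piMl// mdist_ge0.
have lr : l * mdist p r <= mdist p r by rewrite ler_piMl// mdist_ge0.
have lq0 : 0 <= l * mdist p q by rewrite mulr_ge0// mdist_ge0.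
have lr0 : 0 <= l * mdist p r by rewrite mulr_ge0// mdist_ge0.
have t1 := mdist_triangle r p q; have t2 := mdist_triangle q p r.
have t3 := mdist_triangle p q r.
rewrite (mdist_sym r q) in t1; rewrite (mdist_sym q p) in t3.
have [q' [r' [pq pr qr]]] := comparison_triangle (mdist_ge0 p q) (mdist_ge0 p r)
  (mdist_ge0 q r) t1 t2 t3.
have scale (z : R * R) (m : R) : 0 <= m -> edist (0, 0) (m * z.1, m * z.2) = m * edist
  (0, 0) z.
  move=> m0; apply: edist_eq; first by rewrite mulr_ge0 ?edist_ge0.
  by rewrite exprMn -edist_sq /=; ring.
have coscale (z : R * R) : edist (l * z.1, l * z.2) z = edist (0, 0) z - l * edist (0,
  0) z.
  apply: edist_eq; first by rewrite subr_ge0 ler_piMl ?edist_ge0.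
  by rewrite -{1}[edist (0, 0) z]mul1r -mulrBl exprMn -edist_sq /=; ring.
have -> : l * mdist q r = edist (l * q'.1, l * q'.2) (l * r'.1, l * r'.2).
  apply/esym/edist_eq; first by rewrite mulr_ge0// mdist_ge0.
  by rewrite exprMn -qr -edist_sq /=; ring.
apply: (cX (segmentI gb) (segmentI gc) _ _ pq pr qr).
- by exists (l * mdist p q) => //=; rewrite in_itv/= lq0.
- by exists (l * mdist p r) => //=; rewrite in_itv/= lr0.
- by rewrite scale// pq (geodesic_dist0 gb).
- by rewrite coscale pq (geodesic_dist1 gb).
- by rewrite scale// pr (geodesic_dist0 gc).
- by rewrite coscale pr (geodesic_dist1 gc).
Qed.

Hypothesis gX : geodesic_space X.

(** Pass through the geodesic [u] from [c 0] to [c' T]. The triangle with apex [c 0] contributes at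
    most [t / T * M], which is made smaller than [e] by the choice of [T]; the one with apex [c' T]
    contributes at most [mdist (c 0) (c' 0)]. *)
Lemma cat0_rays_fellow_travel c c' (t : R) :
  ray c -> ray c' -> asymptotic c c' -> 0 <= t ->
  mdist (c t) (c' t) <= mdist (c 0) (c' 0).
Proof.
move=> rc rc' [M HM] t0.
have M0 : 0 <= M by apply: le_trans (mdist_ge0 _ _) (HM 0 _).
apply/ler_addgt0Pr => e e0.
pose T : R := t + t * M / e + 1.
have tMe : 0 <= t * M / e by rewrite !mulr_ge0// invr_ge0 ltW.
have T0 : 0 < T by rewrite /T; lra.
have [u gu] := gX (c 0) (c' T).
have gc := ray_geodesic rc (ltW T0); have gc' := ray_geodesic rc' (ltW T0).
have dc : mdist (c 0) (c T) = T.
  by rewrite rc ?in_itv/= ?lexx ?(ltW T0)// sub0r normrN ger0_norm// ltW.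
have dc' : mdist (c' T) (c' 0) = T.
  by rewrite rc' ?in_itv/= ?lexx ?(ltW T0)// subr0 ger0_norm// ltW.
pose l : R := t / T.
have l0 : 0 <= l by rewrite divr_ge0// ltW.
have l1 : l <= 1 by rewrite ler_pdivrMr// mul1r /T; lra.
have lT : l * T = t by rewrite /l divfK// gt_eqF.
have := cat0_dilation gc gu l0 l1; rewrite dc lT => h1.
have m0 : 0 <= 1 - l by lra.
have m1 : 1 - l <= 1 by lra.
have := cat0_dilation (geodesic_rev gu) (geodesic_rev gc') m0 m1.
rewrite (mdist_sym (c' T) (c 0)) (mdist_sym (c' 0)) dc'.
rewrite !mulrBl !mul1r !subKr lT => h2.
have h3 : l * mdist (c T) (c' T) <= e.
  have : l * mdist (c T) (c' T) <= l * M by rewrite ler_wpM2l// HM// ltW.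
  move/le_trans; apply; rewrite /l mulrAC ler_pdivrMr// (mulrC e) /T !mulrDl mul1r.
  by rewrite divfK ?gt_eqF//; have := mulr_ge0 t0 (ltW e0); lra.
have := mdist_triangle (u (l * mdist (c 0) (c' T))) (c t) (c' t).
have := mulr_ge0 l0 (mdist_ge0 (c 0) (c' 0)); lra.
Qed.

(** Dilation compares the geodesics at proportional times; returning to equal times costs the same
    amount once more, whence the factor 2. *)
Lemma cat0_geodesics_close o p q b c (r : R) : geodesic b o p -> geodesic c o q ->
  0 <= r -> r <= mdist o p -> r <= mdist o q -> 0 < mdist o q ->
  mdist (b r) (c r) * mdist o q <= 2 * r * mdist p q.
Proof.
move=> gb gc r0 rp rq q0.
pose l : R := r / mdist o q.
have l0 : 0 <= l by rewrite divr_ge0// ltW.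
have l1 : l <= 1 by rewrite ler_pdivrMr// mul1r.
have lq : l * mdist o q = r by rewrite /l divfK// gt_eqF.
have := cat0_dilation gb gc l0 l1; rewrite lq => h1.
have h2 : mdist (b r) (b (l * mdist o p)) <= l * mdist p q.
  have lp0 : 0 <= l * mdist o p by exact: mulr_ge0 l0 (mdist_ge0 _ _).
  have lp1 : l * mdist o p <= mdist o p by rewrite ler_piMl// mdist_ge0.
  have [_ _ ->] := gb; rewrite ?in_itv/= ?r0 ?rp ?lp0//.
  rewrite -{1}lq -mulrBr normrM (ger0_norm l0) ler_wpM2l// ler_norml.
  have := mdist_triangle p o q; have := mdist_triangle q o p.
  by rewrite (mdist_sym q p); lra.
have := mdist_triangle (b (l * mdist o p)) (b r) (c r) => h3.
have : mdist (b r) (c r) <= 2 * (l * mdist p q) by lra.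
rewrite -(ler_pM2r q0) => /le_trans; apply.
by rewrite -lq; lra.
Qed.

End CAT0.

(** * Dynamics of hyperbolic elements on the boundary *)

(** The CAT(0) bound is weakened to the shape of the hyperbolic one. What counts is that [E] does
    not depend on the rays, in contrast to the bound contained in [asymptotic]. *)
Lemma rays_fellow_travel (k : npc_kind) (R : realType) (X : metricType R) :
  npc_space k X -> exists E : R, forall (c c' : R -> X) (t : R),
    ray c -> ray c' -> asymptotic c c' -> 0 <= t ->
    mdist (c t) (c' t) <= 3 * mdist (c 0) (c' 0) + E.
Proof.
case: k => /= -[gX].
- move=> [_ cX]; exists 0 => c c' t rc rc' cc' t0.
  have := cat0_rays_fellow_travel cX gX rc rc' cc' t0.
  by have := mdist_ge0 (c 0) (c' 0); lra.
- move=> [_ [delta d0 dX]]; exists (4 * delta) => c c' t rc rc' cc' t0.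
  exact: gromov_rays_fellow_travel.
Qed.

(** The index [m] may differ from [n], so that orbits of different elements can be compared. Gromov
    products change by at most [C]; in the cone topology, geodesics to far points at bounded
    distance are close at time [r]. *)
Lemma tends_to_close (k : npc_kind) (R : realType) (X : metricType R)
    (u v : nat -> X) (xi : boundary X) (C : R) :
  npc_space k X -> tends_to k u xi ->
  (forall M, exists N, forall n, (N <= n)%N ->
     exists2 m, (M <= m)%N & mdist (v n) (u m) <= C) ->
  tends_to k v xi.
Proof.
case: k => /= -[gX].
- move=> [_ cX] h close o; have [c xic H] := h o; exists c => // r e r0 e0.
  have C0 : 0 <= C.
    have [N HN] := close 0; have [m _] := HN N (leqnn N).
    exact/le_trans/mdist_ge0.
  (* At time [r] the geodesics to [v n] and [u m] are at most [2 * r * C / mdist o (v n)] apart; the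
     summand [4 * r * C / e] makes this less than [e / 2]. *)
  pose r' : R := r + C + 4 * r * C / e + 1.
  have rCe : 0 <= 4 * r * C / e.
    by rewrite divr_ge0 ?(ltW e0)// !mulr_ge0// ltW.
  have r'0 : 0 < r' by rewrite /r'; lra.
  have e20 : 0 < e / 2 by rewrite divr_gt0.
  have [N1 H1] := H r' _ r'0 e20; have [N2 H2] := H r _ r0 e20.
  have [N HN] := close (maxn N1 N2); exists N => n /HN[m].
  rewrite geq_max => /andP[/H1[du _] /H2[_ Hb]] vu.
  have dv : r + 4 * r * C / e < mdist o (v n).
    have := mdist_triangle (v n) o (u m); move: du; rewrite /r'; lra.
  split=> [|b gb]; first by lra.
  have [b' gb'] := gX o (u m).
  have := Hb _ gb'; have := mdist_triangle (b' r) (b r) (c r).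
  have v0 : 0 < mdist o (v n) by lra.
  have ru : r <= mdist o (u m) by move: du; rewrite /r'; lra.
  have rv : r <= mdist o (v n) by lra.
  have := cat0_geodesics_close cX gb' gb (ltW r0) ru rv v0.
  rewrite (mdist_sym (u m)) (mdist_sym (b' r)) => h1 h2 h3.
  suff : mdist (b r) (b' r) < e / 2 by lra.
  rewrite -(ltr_pM2r v0); apply: (le_lt_trans h1).
  have : 2 * r * mdist (v n) (u m) <= 2 * r * C by rewrite ler_pM2l//; lra.
  move/le_lt_trans; apply.
  have h4 : e / 2 * (r + 4 * r * C / e) < e / 2 * mdist o (v n) by rewrite ltr_pM2l.
  apply: le_lt_trans h4.
  have -> : e / 2 * (r + 4 * r * C / e) = e / 2 * r + 2 * r * C.
    by field; rewrite gt_eqF.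
  by have := mulr_ge0 (ltW e20) (ltW r0); lra.
- move=> _ h close o c xic M; have [N [T H]] := h o c xic (M + C).
  have [N' HN'] := close N; exists N', T => n t /HN'[m Nm vu] Tt.
  have := H m t Nm Tt; rewrite /gromov_product.
  have := mdist_triangle (v n) o (u m).
  have := mdist_triangle (u m) (v n) (c t); lra.
Qed.

Section HyperbolicElements.
Variables (G : groupType) (R : realType) (X : metricType R) (a : isometric_action G X).
Variable (k : npc_kind).
Hypothesis hX : npc_space k X.
Implicit Types (g h : G) (x y : X) (xi : boundary X).

Lemma hyperbolicV g : hyperbolic a k g -> hyperbolic a k g^-1.
Proof.
case: k => /=.
- move=> [c [l [ci l0 gc]]]; exists (fun t => c (- t)), l; split => // [s t _ _|t].
    by rewrite ci ?in_itv//= -opprD normrN.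
  by rewrite -{1}[- t](subrK l) -gc actK opprD.
- move=> [x [L [C [L1 C0 H]]]]; exists x, L, C; split => // m n.
  have zV i : expgz g^-1 i = expgz g (- i).
    by case: i => [[|i]|i] //=; rewrite ?expVgn ?invgK ?invg1// ?opprK.
  have := H (- m) (- n); rewrite !zV.
  by rewrite -opprD normrN.
Qed.

Lemma hyperbolic_conj g h : hyperbolic a k g -> hyperbolic a k (h * g / h)%g.
Proof.
have conjX n : ((h * g / h) ^+ n = h * g ^+ n / h)%g.
  elim: n => [|n IH]; first by rewrite !expg0 mulg1 mulgV.
  by rewrite !expgS IH !mulgA mulgVK.
case: k => /=.
- move=> [c [l [ci l0 gc]]]; exists (a h \o c), l; split => // [s t s0 t0|t].
    by rewrite /= act_isometry ci.
  by rewrite /= !actM actK gc.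
- move=> [x [L [C [L1 C0 H]]]]; exists (a h x), L, C; split => // m n.
  have zE i : a (expgz (h * g / h)%g i) (a h x) = a h (a (expgz g i) x).
    case: i => i; rewrite /expgz conjX ?invgF ?invgK.
      by rewrite !actM actK.
    by rewrite -!actM; congr (a _ x); rewrite invgM !mulgA mulgVK.
  by rewrite !zE !act_isometry.
Qed.

Lemma attracting_conj g h xi : attracting a k g xi ->
  attracting a k (h * g / h)%g (boundary_act a h xi).
Proof.
move=> gxi x; have := tends_to_act a h (gxi (a h^-1%g x)).
congr tends_to; apply/funext => n; rewrite -!actM; congr (a _ x).
elim: n => [|n IH]; first by rewrite !expg0 mulg1 mulgV.
by rewrite !expgS -IH !mulgA mulgVK.
Qed.

(** A common substitute for an axis. In the CAT(0) case an axis itself qualifies: the geodesics from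
    [c 0] to its translates run along [c], so [c] agrees with the ray of [xi] to which they
    converge. *)
Lemma quasi_axis g xi : hyperbolic a k g -> attracting a k g xi ->
  exists2 c, rays xi c & exists D : R, forall n : nat,
    exists2 t, 0 <= t & mdist (a (g ^+ n)%g (c 0)) (c t) <= D.
Proof.
move: hX; case: k => /= -[gX].
- move=> _ [c [l [ci l0 gc]]] gxi.
  have gcn n t : a (g ^+ n)%g (c t) = c (t + n%:R * l).
    elim: n => [|n IH]; first by rewrite expg0 act1 mul0r addr0.
    by rewrite expgS actM IH gc -natr1 mulrDl mul1r addrA.
  have rc : ray c by move=> s t _ _; rewrite ci ?in_itv.
  exists c; last first.
    exists 0 => n; exists (n%:R * l); first by rewrite mulr_ge0// ltW.
    by rewrite gcn add0r mdistxx.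
  have [c' [xic' c'0] H] := gxi (c 0) (c 0).
  apply: (boundary_asymptotic xic' rc); exists 0 => t;
    rewrite le_eqVlt => /orP[/eqP<-|t0].
    by rewrite c'0 mdistxx.
  apply/ler_addgt0Pr => e e0; rewrite add0r.
  have [N HN] := H _ _ t0 e0; have [_ HN2] := HN N (leqnn N).
  rewrite mdist_sym ltW// HN2// gcn add0r; apply: ray_geodesic => //.
  by rewrite mulr_ge0// ltW.
- move=> [_ [delta d0 dX]] [x0 qi] gxi.
  have [c xic _] := boundary_nonempty xi; exists c => //.
  exact: (gromov_quasi_axis gX dX d0 qi gxi xic).
Qed.

Lemma orbit_escape g : hyperbolic a k g -> forall x (M : R), exists N, forall n,
  (N <= n)%N -> M <= mdist x (a (g ^+ n)%g x).
Proof.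
move=> hg x M.
suff [l [C [l0 H]]] : exists l C : R,
    0 < l /\ forall n, l * n%:R - C <= mdist x (a (g ^+ n)%g x).
  exists (Num.trunc ((M + C) / l)).+1 => n Nn; apply: le_trans (H n).
  suff : (M + C) / l <= n%:R by rewrite ler_pdivrMr//; lra.
  by apply: le_trans (ltW (truncnS_gt _)) _; rewrite ler_nat.
move: hg; case: k => /= [[c [l [ci l0 gc]]]|[x0 qi]].
- exists l, (2 * mdist x (c 0)); split=> // n.
  have gcn : a (g ^+ n)%g (c 0) = c (n%:R * l).
    elim: n => [|n IH]; first by rewrite expg0 act1 mul0r.
    by rewrite expgS actM IH gc -natr1 mulrDl mul1r.
  have := orbit_basepoint a (g ^+ n)%g (c 0) x.
  rewrite gcn ci ?in_itv//= sub0r normrN ger0_norm ?mulr_ge0 ?(ltW l0)//.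
  by rewrite (mdist_sym (c 0) x); lra.
- exact: quasi_isometric_growth qi.
Qed.

Lemma displacement_bound g xi x (C : R) :
  hyperbolic a k g -> attracting a k g xi ->
  exists C', forall h, boundary_act a h xi = xi -> mdist (a h x) x <= C ->
    forall n, mdist (a h (a (g ^+ n)%g x)) (a (g ^+ n)%g x) <= C'.
Proof.
move=> hg gxi; have [c xic [D HD]] := quasi_axis hg gxi.
have [E HE] := rays_fellow_travel hX.
have rc := boundary_ray xic.
(* The displacement of [h] is carried from [x] to [c 0], along the ray to [c t], then to [g^n (c 0)]
   at cost [2 * D], and finally to [g^n x]. *)
exists (2 * D + 3 * (C + 2 * mdist x (c 0)) + E + 2 * mdist x (c 0)).
move=> h hxi hx n; have [t t0 ht] := HD n.
have xihc : rays xi (a h \o c) by rewrite -hxi; exists c.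
have := HE _ _ t (boundary_ray xihc) rc (boundary_asymptotic2 xihc xic) t0.
rewrite /=.
have := orbit_basepoint a h (c 0) x; rewrite (mdist_sym (c 0) x).
have e1 : mdist (a (g ^+ n)%g x) (a (g ^+ n)%g (c 0)) = mdist x (c 0).
  by rewrite act_isometry.
set p := a _ x in e1 *; set q := a _ (c 0) in e1 ht.
have := orbit_basepoint a h p q; rewrite e1.
have := orbit_basepoint a h q (c t).
move: hx ht; rewrite (mdist_sym (a h x)) (mdist_sym (a h p)) (mdist_sym (a h (c 0)))
  (mdist_sym (a h (c t))).
lra.
Qed.

Lemma bounded_displacement_fixes g xi x h (C : R) : attracting a k g xi ->
  (forall n, mdist (a h (a (g ^+ n)%g x)) (a (g ^+ n)%g x) <= C) ->
  boundary_act a h xi = xi.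
Proof.
move=> gxi H; apply: (tends_to_unique hX (tends_to_act a h (gxi x))).
apply: (tends_to_close (C := C) hX (gxi x)) => M; exists M => n Mn.
by exists n.
Qed.

(** The forward orbit of [g] is coarsely dense in a ray of [xi]: the times [t m] of the ray that it
    follows are unbounded and increase by at most [2 * D + f] per step. The orbit of [h] follows an
    asymptotic ray. *)
Lemma same_attracting_close g h xi x :
  hyperbolic a k g -> hyperbolic a k h ->
  attracting a k g xi -> attracting a k h xi ->
  exists C, forall n, exists m, mdist (a (h ^+ n)%g x) (a (g ^+ m)%g x) <= C.
Proof.
move=> hg hh gxi hxi; have [c xic [D HD]] := quasi_axis hg gxi.
have [c' xic' [D' HD']] := quasi_axis hh hxi.
have rc := boundary_ray xic.
have [M HM] := boundary_asymptotic2 xic' xic.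
pose f := mdist (c 0) (a g (c 0)).
have cover s : 0 <= s -> exists m, mdist (c s) (a (g ^+ m)%g (c 0)) <= 3 * D + f.
  move=> s0.
  pose t m := s2val (cid2 (HD m)).
  have t0 m : 0 <= t m by rewrite /t; case: cid2.
  have tD m : mdist (a (g ^+ m)%g (c 0)) (c (t m)) <= D by rewrite /t; case: cid2.
  have dc u v : 0 <= u -> 0 <= v -> mdist (c u) (c v) = `|u - v|.
    by move=> u0 v0; rewrite rc ?in_itv/= ?u0 ?v0.
  have f0 : 0 <= f by exact: mdist_ge0.
  have D0 : 0 <= D by apply: le_trans (mdist_ge0 _ _) (tD 0).
  have ex : exists m, s < t m.
    have [N HN] := orbit_escape hg (c 0) (D + s + 1).
    exists N; have := HN N (leqnn N); have := tD N.
    have := mdist_triangle (c (t N)) (c 0) (a (g ^+ N)%g (c 0)).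
    rewrite dc// sub0r normrN ger0_norm// (mdist_sym (c (t N))); lra.
  case: (ex_minnP ex) => -[|m] st mmin.
    exists 0; rewrite expg0 act1 dc// subr0 ger0_norm//.
    have := tD 0; rewrite expg0 act1 dc// sub0r normrN ger0_norm//; lra.
  have ts : t m <= s.
    by rewrite leNgt; apply/negP => /mmin; rewrite ltnn.
  exists m; have := tD m; have := tD m.+1.
  have := orbit_shift a g (c 0) m 1; rewrite addn1 expg1 -/f.
  have := mdist_triangle (c (t m)) (c s) (a (g ^+ m)%g (c 0)).
  rewrite dc// ger0_norm ?subr_ge0// (mdist_sym (c (t m))).
  have := mdist_triangle (a (g ^+ m.+1)%g (c 0)) (c (t m.+1)) (a (g ^+ m)%g (c 0)).
  have := mdist_triangle (a (g ^+ m)%g (c 0)) (c (t m.+1)) (c (t m)).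
  rewrite dc// ger0_norm ?subr_ge0 ?(le_trans ts (ltW st))//.
  rewrite (mdist_sym (a (g ^+ m.+1)%g _) (a (g ^+ m)%g _)).
  rewrite (mdist_sym (c (t m.+1)) (a (g ^+ m)%g _)) (mdist_sym (c (t m.+1)) (a (g ^+
    m.+1)%g _)).
  by lra.
exists (mdist x (c' 0) + D' + M + (3 * D + f) + mdist (c 0) x) => n.
have [t t0 ht] := HD' n; have [m hm] := cover _ t0; exists m.
have := HM _ t0; have := act_isometry a (h ^+ n)%g x (c' 0).
have := act_isometry a (g ^+ m)%g (c 0) x.
have := mdist_triangle (a (h ^+ n)%g (c' 0)) (a (h ^+ n)%g x) (a (g ^+ m)%g x).
have := mdist_triangle (c' t) (a (h ^+ n)%g (c' 0)) (a (g ^+ m)%g x).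
have := mdist_triangle (c t) (c' t) (a (g ^+ m)%g x).
have := mdist_triangle (a (g ^+ m)%g (c 0)) (c t) (a (g ^+ m)%g x).
by lra.
Qed.

End HyperbolicElements.

(** * Topological groups *)

(** Otherwise the parts of [K] and [f i] outside [O] generate a proper filter, and a cluster point
    of it in [K] lies in every [f i] but not in [O]. *)
Lemma compact_directed (T : topologicalType) (I : Type) (D : set I) (f : I -> set T)
    (K O : set T) :
  compact K -> open O -> D !=set0 -> (forall i, D i -> closed (f i)) ->
  (forall i j, D i -> D j -> exists2 l, D l & f l `<=` f i `&` f j) ->
  K `&` \bigcap_(i in D) f i `<=` O -> exists2 i, D i & K `&` f i `<=` O.
Proof.
move=> cK oO [i0 Di0] cf dir KO; apply: contrapT => H.
pose F := filter_from D (fun i => (K `&` f i) `\` O).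
have FF : ProperFilter F.
  apply: filter_from_proper.
    apply: filter_from_filter; first by exists i0.
    move=> i j Di Dj; have [l Dl lij] := dir _ _ Di Dj;
      exists l => // x [[Kx /lij[fi fj]] Ox].
    by split; split.
  move=> i Di; apply/set0P/eqP => h; apply: H; exists i => //.
  by move: h => /seteqP[h _] x Kx; apply: contrapT => Ox; apply: (h x).
have FK : F K by exists i0 => // x [[]].
have [x [Kx clx]] := cK _ FF FK.
have fx i : D i -> f i x.
  move=> Di; apply: (cf i Di) => B xB.
  have [|y [fy By]] := clx (f i) B _ xB; last by exists y.
  by exists i => // y [[]].
have Ox : O x by apply: KO; split => // i /fx.
have [|y [[_ nOy] Oy]] := clx ((K `&` f i0) `\` O) O _ (open_nbhs_nbhs (conj oO Ox)) =>
  //.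
by exists i0.
Qed.

Lemma compact_nested (T : topologicalType) (K : set T) (f : nat -> set T) :
  compact K -> (forall n, closed (f n)) -> (forall n, f n.+1 `<=` f n) ->
  (forall n, K `&` f n !=set0) -> exists2 x, K x & forall n, f n x.
Proof.
move=> cK cf fS Kf; apply: contrapT => H.
have fle m n : (m <= n)%N -> f n `<=` f m.
  elim: n => [|n IH]; first by rewrite leqn0 => /eqP->.
  by rewrite leq_eqVlt ltnS => /orP[/eqP->//|/IH h x /fS/h].
have [|i j _ _||i _ Kfi] := @compact_directed T nat setT f K set0 cK (@open0 _) _ (fun
  n _ => cf n).
- by exists 0%N.
- by exists (maxn i j) => // x fx; split; apply: fle fx; rewrite ?leq_maxl ?leq_maxr.
- by move=> x [Kx fx]; apply: H; exists x => // n; exact: fx.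
by have [x /Kfi] := Kf i.
Qed.

Section TopologicalGroups.
Variable G : topGroupType.
Implicit Types (U V W K L B : set G) (g h x y : G).

Lemma subgroup1 U : is_subgroup U -> U 1%g. Proof. by case. Qed.

Lemma subgroupV U x : is_subgroup U -> U x -> U x^-1%g.
Proof. by move=> [U1 UD] Ux; rewrite -div1g; exact: UD. Qed.

Lemma subgroupM U x y : is_subgroup U -> U x -> U y -> U (x * y)%g.
Proof.
by move=> sU Ux Uy; rewrite -[y]invgK; case: (sU) => _; apply => //; exact: subgroupV.
Qed.

Lemma subgroupX U x n : is_subgroup U -> U x -> U (x ^+ n)%g.
Proof.
move=> sU Ux; elim: n => [|n IH]; first by rewrite expg0; exact: subgroup1.
by rewrite expgS; exact: subgroupM.
Qed.

Lemma continuous_mulg (T : topologicalType) (f1 f2 : T -> G) :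
  continuous f1 -> continuous f2 -> continuous (fun t => (f1 t * f2 t)%g).
Proof.
move=> c1 c2 t; apply: (@continuous_comp _ _ _ (fun t => (f1 t, f2 t))
  (fun q : G * G => (q.1 * q.2)%g)); last exact: mulg_continuous.
by apply: cvg_pair; [exact: c1 | exact: c2].
Qed.

Lemma continuous_invg (T : topologicalType) (f : T -> G) :
  continuous f -> continuous (fun t => (f t)^-1%g).
Proof.
by move=> c t; apply: (@continuous_comp _ _ _ f (fun y : G => y^-1%g));
  [exact: c|exact: invg_continuous].
Qed.

Lemma continuous_lmul g : continuous (fun x => (g * x)%g).
Proof. by apply: continuous_mulg; [move=> ?; exact: cvg_cst | move=> ?;
  exact: cvg_id]. Qed.

Lemma continuous_rmul g : continuous (fun x => (x * g)%g).
Proof. by apply: continuous_mulg; [move=> ?; exact: cvg_id | move=> ?;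
  exact: cvg_cst]. Qed.

Lemma continuous_conjugate g : continuous (fun x => (g * x / g)%g).
Proof.
by apply: continuous_mulg; [exact: continuous_lmul | move=> ?; exact: cvg_cst].
Qed.

Lemma compact_image (T S : topologicalType) (f : T -> S) (A : set T) :
  continuous f -> compact A -> compact (f @` A).
Proof. by move=> cf; apply: continuous_compact; exact: continuous_subspaceT. Qed.

Lemma open_lmul g U : open U -> open [set x | U (g * x)%g].
Proof. by apply: (iffLR (continuousP _)); exact: continuous_lmul. Qed.

Lemma open_rmul g U : open U -> open [set x | U (x * g)%g].
Proof. by apply: (iffLR (continuousP _)); exact: continuous_rmul. Qed.

(** Tube lemma along the product of [K] with the unit. *)
Lemma nbhs1_compact (f : G * G -> G) (K O : set G) :
  compact K -> continuous f -> open O -> (forall x, K x -> O (f (x, 1%g))) ->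
  \forall y \near (1%g : G), forall x, K x -> O (f (x, y)).
Proof.
move=> /compact_near_coveringP cK cf oO KO.
apply: (cK _ (nbhs (1%g : G)) (fun y x => O (f (x, y)))) => x Kx.
have [[A B] /= nAB AB] := cf (x, 1%g) O (open_nbhs_nbhs (conj oO (KO x Kx))).
by exists (A, B) => // -[u v] uv; exact: (AB (u, v)).
Qed.

Lemma subgroup_open U : is_subgroup U -> nbhs (1%g : G) U -> open U.
Proof.
move=> sU nU; rewrite openE => x Ux; rewrite /interior /=.
have : nbhs x [set y | U (x^-1 * y)%g].
  by apply: (continuous_lmul (g := x^-1%g) (x := x)); rewrite /= mulVg.
apply: filterS => y /= Uy; rewrite -[y](mulVKg x); exact: subgroupM.
Qed.

Lemma open_subgroup_closed U : is_subgroup U -> open U -> closed U.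
Proof.
move=> sU oU x clx.
have : nbhs x [set y | U (x^-1 * y)%g].
  by apply: open_nbhs_nbhs; split; [exact: open_lmul | rewrite /= mulVg;
    exact: subgroup1].
move=> /clx[y [Uy /= Uxy]].
have -> : x = (y / (x^-1 * y))%g by rewrite invgM invgK mulgA mulgV mul1g.
by case: sU => _; apply.
Qed.

(** The finite subcover is read off the filter of finite lists in [K] ordered by inclusion: near
    every point of [K], all sufficiently large lists work. *)
Lemma compact_finite_cosets K V : is_subgroup V -> open V -> compact K ->
  exists s : seq G, [set` s] `<=` K /\ forall x, K x -> exists2 y, y \in s & V (y^-1 *
    x)%g.
Proof.
move=> sV oV /compact_near_coveringP cK.
pose D := [set s : seq G | [set` s] `<=` K].
pose F := filter_from D (fun s => [set s' | D s' /\ {subset s <= s'}]).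
have FF : ProperFilter F.
  apply: filter_from_proper; last by move=> s Ds; exists s; split.
  apply: filter_from_filter; first by exists [::].
  move=> s s' Ds Ds'; exists (s ++ s').
    by move=> x /=; rewrite mem_cat => /orP[/Ds|/Ds'].
  move=> t [Dt st]; split; split => // x xs; apply: st; rewrite mem_cat xs ?orbT//.
have FD : F D by exists [::] => // s [].
suff FK : F [set s : seq G | K `<=` (fun x => exists2 y, y \in s & V (y^-1 * x)%g)].
  by have [s [Ds sK]] := filter_ex (filterI FD FK); exists s.
apply: (cK _ F (fun (s : seq G) x => exists2 y, y \in s & V (y^-1 * x)%g)) => x Kx.
exists ([set y | V (x^-1 * y)%g], [set s' | D s' /\ {subset [:: x] <= s'}]).
  split => /=; last by exists [:: x] => // y /=; rewrite inE => /eqP->.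
  by apply: open_nbhs_nbhs; split; [exact: open_lmul | rewrite /= mulVg;
    exact: subgroup1].
by move=> [y s] /= [Vy [_ xs]]; exists x => //; apply: xs; rewrite inE.
Qed.

(** If [N] is a neighbourhood of the unit with [N^-1 N K] disjoint from [C], then [N K] and [N C]
    are disjoint. This holds in every topological group and yields the Hausdorff property below. *)
Lemma separate_compact_closed K C : compact K -> closed C -> K `&` C = set0 ->
  exists U V, [/\ open U, open V, K `<=` U, C `<=` V & U `&` V = set0].
Proof.
move=> cK cC KC0.
have [N [oN N1] NV] : exists2 N : set G, open_nbhs 1%g N &
    forall x y, N x -> N y -> forall z, K z -> ~ C (x^-1 * y * z)%g.
  have h : \forall y \near (1%g : G), forall x, K x -> (~` C) (y * x)%g.
    apply: (@nbhs1_compact (fun p => p.2 * p.1)%g); rewrite //.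
    - by apply: continuous_mulg => ?; [exact: cvg_snd | exact: cvg_fst].
    - exact: closed_openC.
    - by move=> x Kx /=; rewrite mul1g => Cx; have : set0 x by rewrite -KC0.
  have c : continuous (fun p : G * G => (p.1^-1 * p.2)%g).
    apply: continuous_mulg; last by move=> ?; exact: cvg_snd.
    by apply: continuous_invg => ?; exact: cvg_fst.
  have := c (1, 1)%g _; rewrite /= mulVg => /(_ _ h)[[A B] [/= nA nB] AB].
  exists (A `&` B)°; first by split; [exact: open_interior | exact: filterI].
  move=> x y /interior_subset[Ax _] /interior_subset[_ By] z Kz.
  exact: (AB (x, y)).
exists (\bigcup_(k in K) [set x | N (x / k)%g]), (\bigcup_(c in C) [set x | N (x / c)%g]).
split.
- by apply: bigcup_open => k _; exact: open_rmul.
- by apply: bigcup_open => k _; exact: open_rmul.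
- by move=> k Kk; exists k => //=; rewrite mulgV.
- by move=> k Kk; exists k => //=; rewrite mulgV.
- apply/seteqP; split => // x [[k Kk /= Nk] [c Cc /= Nc]].
  have := NV _ _ Nc Nk k Kk; apply.
  by rewrite invgF mulgA mulgVK mulgVK.
Qed.

Lemma accessible_hausdorff : (forall x : G, closed [set x]) -> hausdorff_space G.
Proof.
move=> cl1 x y clxy; apply: contrapT => xy.
have [|U [V [oU oV xU yV UV0]]] := separate_compact_closed (@compact_set1 _ x) (cl1 y).
  by apply/seteqP; split => // z [zx zy]; apply: xy; rewrite -zx -zy.
have [z []] := clxy U V (open_nbhs_nbhs (conj oU (xU _ erefl))) (open_nbhs_nbhs (conj
  oV (yV _ erefl))).
by move=> Uz Vz; have : set0 z by rewrite -UV0.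
Qed.

Lemma compact_open_subgroup_closed U : compact_open_subgroup U -> closed U.
Proof. by case=> sU _ oU; exact: open_subgroup_closed. Qed.

Lemma compact_open_subgroupI U V : compact_open_subgroup U -> compact_open_subgroup V ->
  compact_open_subgroup (U `&` V).
Proof.
move=> [sU kU oU] [sV kV oV]; split; last exact: openI.
  split; first by split; exact: subgroup1.
  by move=> x y [Ux Vx] [Uy Vy]; split; [exact: sU.2|exact: sV.2].
by apply: compact_closedI => //; exact: open_subgroup_closed.
Qed.

End TopologicalGroups.

(** * Van Dantzig's theorem *)

Section VanDantzig.
Variable G : topGroupType.
Implicit Types (U V W K L B : set G) (g h x y : G).

Lemma tdlc_closed1 x : tdlc G -> closed [set x].
Proof.
move=> [td _]; rewrite -(td x I); apply: component_closed; exact: closedT.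
Qed.

Lemma tdlc_hausdorff : tdlc G -> hausdorff_space G.
Proof. by move=> tG; apply: accessible_hausdorff => x; exact: tdlc_closed1. Qed.

(* The intersection [Q] of the relatively clopen neighbourhoods of [1] in a compact
   neighbourhood is connected, hence reduced to [1]. *)
Lemma tdlc_compact_open_nbhs (N : set G) : tdlc G -> nbhs 1%g N ->
  exists W, [/\ compact W, open W, W 1%g & W `<=` N].
Proof.
move=> tG nN; have hG := tdlc_hausdorff tG; have [td lc] := tG.
have [K nK [cK clK]] : compact_near (nbhs (1%g : G)).
  have [K nK cK] := lc 1%g I; exists K => //.
  have {}nK : nbhs (1%g : G) [set x | setT x -> K x] := nK.
  by apply: filterS nK => x; exact.
(* Clopen relative to [K], expressed by closed sets of [G]. *)
pose relclopen C := [/\ C `<=` K, closed C, closed (K `\` C) & C 1%g].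
pose Q := \bigcap_(C in relclopen) C.
have rcK : relclopen K.
  by split; rewrite ?setDv; [| |exact: closed0|exact: nbhs_singleton].
have rcI C C' : relclopen C -> relclopen C' -> relclopen (C `&` C').
  move=> [CK c1 c2 C1] [C'K c1' c2' C1']; split => //; first by move=> x [/CK].
    exact: closedI.
  by rewrite setDIr; exact: closedU.
have small O : open O -> Q `<=` O -> exists2 C, relclopen C & C `<=` O.
  move=> oO QO.
  have [||||C rC CO] := @compact_directed G (set G) relclopen id K O cK oO.
  - by exists K.
  - by move=> C [].
  - by move=> C C' rC rC'; exists (C `&` C') => //; exact: rcI.
  - by move=> x [_ Qx]; exact: QO.
  by exists C => // x Cx; apply: CO; split => //; case: rC => CK _ _ _; exact: CK.
have clQ : closed Q by apply: closed_bigI => C [].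
have Q1 : Q 1%g by move=> C [].
have QK : Q `<=` K by move=> x /(_ K rcK).
have Qconn : connected Q.
  have key B D : closed B -> closed D -> B `&` D = set0 -> B `|` D = Q -> B 1%g ->
      D = set0.
    move=> clB clD BD0 BDQ B1.
    have cB : compact B.
      by apply: subclosed_compact clB cK _; apply: subset_trans QK; rewrite -BDQ.
    have [U [V [oU oV BU DV UV0]]] := separate_compact_closed cB clD BD0.
    have [||C [CK clC clKC C1] CUV] := small (U `|` V).
    - exact: openU.
    - by rewrite -BDQ; exact: setUSS.
    have UV x : C x -> U x <-> ~ V x.
      move=> Cx; split; first by move=> Ux Vx; have : set0 x by rewrite -UV0.
      by move=> nVx; case: (CUV x Cx).
    (* Cutting [C] down to [U] keeps it relatively clopen, so [Q] lies in [U] and nothing remains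
       for [D]. *)
    have rc : relclopen (C `&` U).
      split; first by move=> x [/CK].
      - suff -> : C `&` U = C `&` ~` V by apply: closedI => //; exact: open_closedC.
        by apply/seteqP; split => x [Cx /(UV x Cx)].
      - suff -> : K `\` (C `&` U) = (K `\` C) `|` (C `&` ~` U).
          by apply: closedU => //; apply: closedI => //; exact: open_closedC.
        apply/seteqP; split => x.
          move=> [Kx nCU]; have [Cx|nCx] := pselect (C x); [right|left]; split => //.
          by move=> Ux; apply: nCU.
        by move=> [[Kx nCx]|[Cx nUx]]; split => //; [move=> []|exact: CK|move=> []].
      - by split => //; exact: BU.
    apply/seteqP; split => // x Dx.
    have [_ Ux] : (C `&` U) x by apply: (_ : Q x); rewrite // -BDQ; right.
    by have : set0 x; rewrite // -UV0; split => //; exact: DV.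
  move=> B [b Bb] [U oU BU] [C clC BC].
  have clB : closed B by rewrite BC; exact: closedI.
  have clD : closed (Q `\` B).
    suff -> : Q `\` B = Q `&` ~` U by apply: closedI => //; exact: open_closedC.
    by rewrite BU setDIr setDv set0U setDE.
  have BQ : B `<=` Q by rewrite BU => x [].
  have [B1|nB1] := pselect (B 1%g).
    have := key B (Q `\` B) clB clD.
    rewrite setDIK setDUK// => /(_ erefl erefl B1).
    by rewrite setD_eq0 => QB; apply/seteqP; split.
  have := key (Q `\` B) B clD clB.
  rewrite setIC setDIK setUC setDUK// => /(_ erefl erefl (conj Q1 nB1)) B0.
  have : set0 b by rewrite -B0.
  by [].
have Q1E : Q `<=` [set 1%g].
  by rewrite -(td 1%g I); apply: connected_component_max.
have nKN : nbhs (1%g : G) (N `&` K) by exact: filterI.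
(* Inside the interior of [K], relatively open implies open in [G]. *)
have [||C [CK clC clKC C1] CN] := small (N `&` K)°.
- exact: open_interior.
- by move=> x /Q1E ->.
exists C; split => //; first exact: subclosed_compact clC cK CK.
- suff -> : C = (N `&` K)° `&` ~` (K `\` C) by apply: openI;
    [exact: open_interior|exact: closed_openC].
  apply/seteqP; split => x; first by move=> Cx; split; [exact: CN|case].
  move=> [/interior_subset[_ Kx] nKC]; apply: contrapT => nCx; exact: nKC.
- by move=> x /CN/interior_subset[].
Qed.

(** The form in which [tdlc] enters the rest of the proof; it passes to a closed subgroup by
    intersecting. *)
Definition van_dantzig := hausdorff_space G /\
  forall N : set G, nbhs 1%g N -> exists2 U, compact_open_subgroup U & U `<=` N.

(** The elements [x] such that left translation by [x] and by its inverse map the compact open [W]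
    into itself form a subgroup [S]. It lies in [W] because [W] contains the unit, and the tube
    lemma makes it open. *)
Lemma tdlc_van_dantzig : tdlc G -> van_dantzig.
Proof.
move=> tG; split; first exact: tdlc_hausdorff.
move=> N /(tdlc_compact_open_nbhs tG)[W [cW oW W1 WN]].
pose S := [set x | forall w, W w -> W (x * w)%g /\ W (x^-1 * w)%g].
have SW : S `<=` W by move=> x /(_ _ W1)[]; rewrite mulg1.
have sS : is_subgroup S.
  split; first by move=> w Ww; rewrite invg1 mul1g.
  move=> x y Sx Sy w Ww; rewrite invgF -!mulgA.
  by split; [apply: (Sx _ _).1; apply: (Sy _ _).2|apply: (Sy _ _).1; apply: (Sx _ _).2].
have nS : nbhs (1%g : G) S.
  have h1 : \forall y \near (1%g : G), forall x, W x -> W (y * x)%g.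
    apply: (@nbhs1_compact _ (fun p => p.2 * p.1)%g) => //.
      by apply: continuous_mulg => ?; [exact: cvg_snd|exact: cvg_fst].
    by move=> x /=; rewrite mul1g.
  have h2 : \forall y \near (1%g : G), forall x, W x -> W (y^-1 * x)%g.
    apply: (@nbhs1_compact _ (fun p => p.2^-1 * p.1)%g) => //.
      apply: continuous_mulg => ?; last exact: cvg_fst.
      by apply: continuous_invg => ?; exact: cvg_snd.
    by move=> x /=; rewrite invg1 mul1g.
  by apply: filterS (filterI h1 h2) => x [h3 h4] w Ww; split; [exact: h3|exact: h4].
have oS := subgroup_open sS nS.
exists S; last exact: subset_trans WN.
split => //; exact: subclosed_compact (open_subgroup_closed sS oS) cW SW.
Qed.

End VanDantzig.

(** * Tidy subgroups *)

Section Tidying.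
Variable G : topGroupType.
Variables al be : G -> G.
Hypotheses (alM : {morph al : x y / (x * y)%g}) (beM : {morph be : x y / (x * y)%g}).
Hypotheses (alK : cancel al be) (beK : cancel be al).
Hypotheses (alC : continuous al) (beC : continuous be).
Hypothesis hG : hausdorff_space G.
Implicit Types (U V W K L B : set G) (g h x y : G).

Lemma morph1 (f : G -> G) : {morph f : x y / (x * y)%g} -> f 1%g = 1%g.
Proof. by move=> fM; apply: (@mulIg _ (f 1%g)); rewrite -fM !mul1g. Qed.

Lemma morphV (f : G -> G) : {morph f : x y / (x * y)%g} -> {morph f : x / x^-1%g}.
Proof.
move=> fM x; have f1 := morph1 fM.
by apply/esym/mulg1_eq; rewrite -fM mulgV.
Qed.

Lemma iter_morph (f : G -> G) n :
  {morph f : x y / (x * y)%g} -> {morph iter n f : x y / (x * y)%g}.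
Proof. by move=> fM x y; elim: n => //= n ->; exact: fM. Qed.

Lemma iter_continuous (T : topologicalType) (f : T -> T) n :
  continuous f -> continuous (iter n f).
Proof.
move=> cf; elim: n => [|n IH] x /=; first exact: cvg_id.
by apply: (continuous_comp (IH x)); exact: cf.
Qed.

Lemma iter_cancel (T : Type) (f f' : T -> T) m n (x : T) : cancel f f' -> (m <= n)%N ->
  iter m f' (iter n f x) = iter (n - m) f x.
Proof.
move=> fK; elim: m n => [|m IH] [|n] //= mn; rewrite ?subn0// subSS.
by rewrite -iterS iterSr /= fK IH.
Qed.

(* [trunc V n] is the intersection of the [al^i V] for [i <= n]; [plus_part V] and
   [minus_part V] are Willis' [V_+] and [V_-], the intersections over all [i >= 0] of
   [al^i V] and of [al^-i V]. *)
Definition trunc V n := [set h | forall i, (i <= n)%N -> V (iter i be h)].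
Definition plus_part V := [set h | forall i, V (iter i be h)].
Definition minus_part V := [set h | forall i, V (iter i al h)].

Lemma subgroup_preimage (f : G -> G) V : {morph f : x y / (x * y)%g} ->
  is_subgroup V -> is_subgroup [set x | V (f x)].
Proof.
move=> fM [V1 VD]; split=> [|x y /= Vx Vy].
  by rewrite /= morph1.
by rewrite fM morphV//; exact: VD.
Qed.

Lemma trunc_subgroup V n : is_subgroup V -> is_subgroup (trunc V n).
Proof.
move=> sV; split=> [i _|x y Vx Vy i ni].
  exact: (subgroup_preimage (iter_morph (i) beM) sV).1.
exact: (subgroup_preimage (iter_morph (i) beM) sV).2 _ _ (Vx i ni) (Vy i ni).
Qed.

Lemma plus_part_subgroup V : is_subgroup V -> is_subgroup (plus_part V).
Proof.
move=> sV; split=> [i|x y Vx Vy i].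
  exact: (subgroup_preimage (iter_morph (i) beM) sV).1.
exact: (subgroup_preimage (iter_morph (i) beM) sV).2 _ _ (Vx i) (Vy i).
Qed.

Lemma trunc0 V n : trunc V n `<=` V.
Proof. by move=> h /(_ 0%N isT). Qed.

Lemma trunc_closed V n : closed V -> closed (trunc V n).
Proof.
move=> cV.
have -> : trunc V n = \bigcap_(i in [set i | (i <= n)%N]) [set h | V (iter i be h)].
  by [].
apply: closed_bigI => i _.
by apply: (iffLR (continuous_closedP _)) => //; exact: iter_continuous.
Qed.

Lemma plus_part_closed V : closed V -> closed (plus_part V).
Proof.
move=> cV.
have -> : plus_part V = \bigcap_(i in setT) [set h | V (iter i be h)].
  by apply/seteqP; split => x Vx; [move=> i _; exact: Vx | move=> i; exact: Vx].
apply: closed_bigI => i _.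
by apply: (iffLR (continuous_closedP _)) => //; exact: iter_continuous.
Qed.

Lemma trunc_open V n : open V -> open (trunc V n).
Proof.
move=> oV; elim: n => [|n IH].
  by rewrite (_ : trunc V 0 = V)//; apply/seteqP; split => [h /(_ 0%N isT)//|h Vh [|]].
rewrite (_ : trunc V n.+1 = trunc V n `&` [set h | V (iter n.+1 be h)]).
  by apply: openI => //; apply: (iffLR (continuousP _)) => //; exact: iter_continuous.
apply/seteqP; split => h; first by move=> Vh; split => [i ni|]; apply: Vh => //;
  exact: leqW.
by move=> [Vh Vn] i; rewrite leq_eqVlt ltnS => /orP[/eqP->//|]; exact: Vh.
Qed.

Lemma trunc_compact_open V n : compact_open_subgroup V -> compact_open_subgroup (trunc
  V n).
Proof.
move=> cV; have [sV kV oV] := cV; split.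
- exact: trunc_subgroup.
- apply: subclosed_compact kV (@trunc0 V n); apply: trunc_closed.
  exact: compact_open_subgroup_closed.
- exact: trunc_open.
Qed.

Lemma plus_part_be V h : plus_part V h -> plus_part V (be h).
Proof. by move=> Vh i; rewrite -iterSr; exact: Vh. Qed.

Lemma plus_part_iter V h n : plus_part V h -> plus_part V (iter n be h).
Proof. by move=> Vh i; rewrite -iterD; exact: Vh. Qed.

Lemma plus_part_trunc V n : plus_part V `<=` trunc V n.
Proof. by move=> h Vh i _; exact: Vh. Qed.

(** By compactness some truncation lies in the open set [O] around the plus part. Write its elements
    as [p z]; then [z] and [al z] belong to the truncation again, since [p] does and
    [be (al z) = z]. *)
Lemma tidy_step V : compact_open_subgroup V -> exists n, forall h, trunc V n h ->
  exists2 p, plus_part V p & trunc V n (p^-1 * h)%g /\ trunc V n (al (p^-1 * h)%g).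
Proof.
move=> cV; have [sV kV oV] := cV; have clV := compact_open_subgroup_closed cV.
pose O := \bigcup_(p in plus_part V) [set h | V (p^-1 * h)%g /\ V (al (p^-1 * h)%g)].
have oO : open O.
  apply: bigcup_open => p _; apply: openI; first exact: open_lmul.
  apply: (iffLR (continuousP (fun h => al (p^-1 * h)%g)) _ V oV) => x.
  by apply: (@continuous_comp _ _ _ _ al); [exact: continuous_lmul|exact: alC].
have [||||N _ HN] := @compact_directed G nat setT (trunc V) V O kV oO.
- by exists 0%N.
- by move=> i _; exact: trunc_closed.
- move=> i j _ _; exists (maxn i j) => // h Vh.
  by split => l li; apply: Vh; rewrite (leq_trans li)// ?leq_maxl ?leq_maxr.
- move=> h [_ Vh]; have ph : plus_part V h by move=> i; exact: (Vh i I i).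
  exists h => //=; rewrite mulVg; split; first exact: subgroup1.
  by rewrite morph1//; exact: subgroup1.
exists N => h Vh; have [p pp [Vz Vaz]] := HN h (conj (trunc0 Vh) Vh).
have Tz : trunc V N (p^-1 * h)%g.
  have sT := trunc_subgroup N sV.
  exact: (subgroupM sT (subgroupV sT (plus_part_trunc pp)) Vh).
exists p => //; split => // -[|i] iN //.
by rewrite iterSr alK; apply: Tz; exact: ltnW.
Qed.

(* [trunc V n] is the product of its plus and minus parts: apply [tidy_step] repeatedly
   and pass to the limit by compactness of [plus_part V]. *)
Lemma tidy_above V : compact_open_subgroup V -> exists n, forall h, trunc V n h ->
  exists2 p, plus_part V p & minus_part (trunc V n) (p^-1 * h)%g.
Proof.
move=> cV; have [sV kV oV] := cV; have clV := compact_open_subgroup_closed cV.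
have [N step] := tidy_step cV; exists N; set V' := trunc V N in step *.
have sV' : is_subgroup V' by exact: trunc_subgroup.
have many n h : V' h -> exists2 p, plus_part V p & forall i, (i <= n)%N -> V' (iter i
  al (p^-1 * h)%g).
  move=> V'h; elim: n => [|n [p pp IH]].
    have [p pp [Vz _]] := step h V'h; exists p => // -[|]//.
  have [p' pp' [Vz Vaz]] := step _ (IH n (leqnn n)).
  have bM := iter_morph (n) beM; have aM := iter_morph (n) alM.
  (* The correction [iter n be p'] becomes [p'] after [n] applications of [al] and is in the plus
     part at all earlier stages, so the conditions already achieved persist. *)
  exists (p * iter n be p')%g.
    by apply: (subgroupM (plus_part_subgroup sV)) => //; exact: plus_part_iter.
  set z := iter n al _ in Vz Vaz.
  have zE : ((p * iter n be p')^-1 * h)%g = iter n be (p'^-1 * z)%g.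
    rewrite invgM -mulgA bM (morphV bM); congr (_ * _)%g.
    by rewrite /z iter_cancel// subnn.
  move=> i; rewrite leq_eqVlt => /orP[/eqP->|ni]; rewrite zE.
    by rewrite iterS iter_cancel// subnn.
  rewrite ltnS in ni.
  rewrite iter_cancel// iter_morph// morphV; last exact: iter_morph.
  apply: (subgroupM sV'); first apply: (subgroupV sV').
    exact: plus_part_trunc (plus_part_iter (n - i) pp').
  by rewrite /z iter_cancel ?leq_subr// subKn//; exact: IH.
move=> h V'h.
have clV' : closed V' by exact: trunc_closed.
have kP : compact (plus_part V).
  by apply: subclosed_compact kV _; [exact: plus_part_closed|move=> x /(_ 0%N)].
have [|||p pp Hp] := @compact_nested G (plus_part V)
    (fun n => [set p | forall i, (i <= n)%N -> V' (iter i al (p^-1 * h)%g)]) kP.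
- move=> n.
  have -> : [set p | forall i, (i <= n)%N -> V' (iter i al (p^-1 * h)%g)] =
      \bigcap_(i in [set i | (i <= n)%N]) [set p | V' (iter i al (p^-1 * h)%g)] by [].
  apply: closed_bigI => i _.
  apply: (iffLR (continuous_closedP (fun p => iter i al (p^-1 * h)%g)) _ V' clV') => x.
  apply: (@continuous_comp _ _ _ (fun p => p^-1 * h)%g (iter i al)).
    apply: continuous_mulg; last by move=> ?; exact: cvg_cst.
    exact: invg_continuous.
  exact: iter_continuous.
- by move=> n p Hp i ni; apply: Hp; exact: leqW.
- by move=> n; have [p pp Hp] := many n h V'h; exists p.
by exists p => // i; exact: (Hp i i).
Qed.

Lemma closure_subgroup B : is_subgroup B -> is_subgroup (closure B).
Proof.
move=> sB; split; first exact: subset_closure (subgroup1 sB).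
move=> x y cx cy A nA.
have c : continuous (fun p : G * G => (p.1 / p.2)%g).
  by apply: continuous_mulg; [|apply: continuous_invg] => ?;
    [exact: cvg_fst|exact: cvg_snd].
have [[A1 A2] /= [n1 n2] A12] := c (x, y) A nA.
have [x' [Bx' Ax']] := cx _ n1; have [y' [By' Ay']] := cy _ n2.
by exists (x' / y')%g; split; [case: sB => _; apply|apply: (A12 (x', y'))].
Qed.

Lemma closure_stable (T : topologicalType) (f : T -> T) (B : set T) : continuous f ->
  (forall x : T, B x -> B (f x)) -> forall x : T, closure B x -> closure B (f x).
Proof.
move=> cf Bf x cx A nA; have [y [By Ay]] := cx _ (cf x A nA).
by exists (f y); split => //; exact: Bf.
Qed.

(* [L] is the closure of the union of the [al^n V_+].  It is compact and [al]-invariant;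
   enlarging [V] to a compact open subgroup [V1] that contains [L] makes the plus part of
   [V1] equal to [L], and then a tidy truncation of [V1] is mapped into itself. *)
Theorem invariant_subgroup V B : compact_open_subgroup V -> compact B ->
  (forall n h, V h -> B (iter n al h)) ->
  exists2 T, compact_open_subgroup T & forall h, T h -> T (al h).
Proof.
move=> cV kB VB; have [sV kV oV] := cV; have clV := compact_open_subgroup_closed cV.
have [N tidy] := tidy_above cV; set V' := trunc V N in tidy.
have cV' : compact_open_subgroup V' by exact: trunc_compact_open.
have [sV' kV' oV'] := cV'; have clV' := compact_open_subgroup_closed cV'.
pose P := [set h | exists n, plus_part V (iter n be h)].
have Pmono m n h : (m <= n)%N -> plus_part V (iter m be h) -> plus_part V (iter n be h).
  by move=> /subnK<-; rewrite iterD; exact: plus_part_iter.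
have sP : is_subgroup P.
  have sp := plus_part_subgroup sV.
  split; first by exists 0%N; exact: subgroup1.
  move=> x y [m xm] [n yn]; exists (maxn m n).
  have bM := iter_morph (maxn m n) beM.
  rewrite bM (morphV bM); apply: (sp.2).
    by apply: Pmono xm; rewrite leq_maxl.
  by apply: Pmono yn; rewrite leq_maxr.
have PB : P `<=` B.
  move=> h [n hn]; have := VB n _ (hn 0%N); rewrite /= iter_cancel// subnn//.
pose L := closure P.
have sL : is_subgroup L by exact: closure_subgroup.
have clL : closed L by exact: closed_closure.
have LB : L `<=` B.
  by rewrite /L (closure_id B).1; [exact: closureS|exact: compact_closed].
have kL : compact L by exact: subclosed_compact clL kB LB.
have alL l : L l -> L (al l).
  apply: closure_stable => // x [n hn]; exists n.+1.
  by rewrite iterSr alK.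
have beL l : L l -> L (be l).
  apply: closure_stable => // x [n hn]; exists n.
  by rewrite -iterSr iterS; exact: plus_part_be.
have iterL (f : G -> G) n l : (forall l, L l -> L (f l)) -> L l -> L (iter n f l).
  by move=> fL Ll; elim: n => //= n; exact: fL.
have pL : plus_part V `<=` L by move=> h hp; apply: subset_closure; exists 0%N.
(* [W] is the largest part of [V'] normalized by [L], so that [W L] is a group; compactness of [L]
   makes it open. *)
pose W := [set h | forall l, L l -> V' (l * h / l)%g].
have WV' : W `<=` V' by move=> h /(_ 1%g (subgroup1 sL)); rewrite mul1g divg1.
have sW : is_subgroup W.
  split=> [l Ll|x y Wx Wy l Ll]; first by rewrite mulg1 mulgV; exact: subgroup1.
  have -> : (l * (x / y) / l = (l * x / l) / (l * y / l))%g.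
    by rewrite mulgKA invgM !mulgA.
  by apply: sV'.2; [exact: Wx|exact: Wy].
have nW : nbhs (1%g : G) W.
  apply: (@nbhs1_compact _ (fun q => q.1 * q.2 / q.1)%g L V') => //.
    apply: continuous_mulg; [apply: continuous_mulg|apply: continuous_invg] => ?;
      by [exact: cvg_fst|exact: cvg_snd].
  by move=> l Ll /=; rewrite mulg1 mulgV; exact: subgroup1.
have WJ l h : L l -> W h -> W (l * h / l)%g.
  move=> Ll Wh l' Ll'; have := Wh (l' * l)%g (subgroupM sL Ll' Ll).
  by rewrite invgM !mulgA.
have oW := subgroup_open sW nW.
have kW : compact W by exact: subclosed_compact (open_subgroup_closed sW oW) kV' WV'.
pose V1 := [set (q.1 * q.2)%g | q in W `*` L].
have WV1 : W `<=` V1.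
  by move=> h Wh; exists (h, 1%g); rewrite /= ?mulg1//; split => //; exact: subgroup1.
have LV1 : L `<=` V1.
  by move=> h Lh; exists (1%g, h); rewrite /= ?mul1g//; split => //; exact: subgroup1.
have sV1 : is_subgroup V1.
  split; first exact: WV1 (subgroup1 sW).
  move=> _ _ [[w l] [/= Ww Ll] <-] [[w' l'] [/= Ww' Ll'] <-].
  have Lll : L (l / l')%g by exact: sL.2.
  exists ((w * ((l / l') * w'^-1 / (l / l')))%g, (l / l')%g); last first.
    by rewrite /= -(mulgA w) mulgVK invgM !mulgA.
  by split => //; apply: (subgroupM sW) => //; apply: WJ => //; exact: (subgroupV sW).
have cV1 : compact_open_subgroup V1.
  split => //.
    apply: compact_image; last exact: compact_setX.
    exact: mulg_continuous.
  by apply: (subgroup_open sV1); apply: filterS nW.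
have [M tidy1] := tidy_above cV1.
exists (trunc V1 M); first exact: trunc_compact_open.
(* For each [n] write [be^n x = w l] and split [w] by [tidy]: one factor stays in [V'] under [al],
   the other belongs to [L]. Hence [x] is a product of an element of [trunc V' n] and one of [L],
   and compactness of [L] yields one factor valid for all [n]. *)
have plusL : plus_part V1 `<=` L.
  move=> x Vx.
  have [|||l Ll Hl] := @compact_nested G L (fun n => [set l | trunc V' n (x / l)%g]) kL.
  - move=> n; apply: (iffLR (continuous_closedP (fun l => (x / l)%g))).
      apply: continuous_mulg; first by move=> ?; exact: cvg_cst.
      exact: invg_continuous.
    exact: trunc_closed.
  - by move=> n l Hl i ni; apply: Hl; exact: leqW.
  - move=> n; have [[w l] [/= Ww Ll] wl] := Vx n.
    have [p pp mp] := tidy _ (subgroupV sV' (WV' _ Ww)).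
    exists (iter n al (p^-1 * l)%g); split.
      by apply: iterL => //; apply: (subgroupM sL) => //; apply: (subgroupV sL);
        exact: pL.
    have aM := iter_morph (n) alM.
    have -> : x = iter n al (w * l)%g by rewrite wl iter_cancel// subnn.
    move=> i ni; rewrite -(morphV aM) -aM iter_cancel//.
    have -> : (w * l / (p^-1 * l) = (p^-1 * w^-1)^-1)%g.
      by rewrite !invgM !invgK !mulgA mulgK.
    by rewrite (morphV (iter_morph (n - i) alM)); apply: (subgroupV sV'); exact: mp.
  have Lxl : L (x / l)%g.
    by apply: pL => i; apply: trunc0; exact: (Hl i i (leqnn i)).
  by rewrite -(mulgVK l x); exact: (subgroupM sL).
have sT := trunc_subgroup M sV1.
(* In [h = p m], the image of [m] stays in the truncation by definition of the minus part, and that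
   of [p] because [L] is contained in [V1] and invariant under both [al] and [be]. *)
move=> h Th; have [p pp mp] := tidy1 h Th.
rewrite -(mulVKg p h) alM; apply: (subgroupM sT); last exact: (mp 1%N).
have Lp : L (al p) by apply: alL; exact: plusL.
by move=> i _; apply: LV1; exact: iterL.
Qed.

End Tidying.

(** * Haar measure *)

Section Packings.
Variable G : topGroupType.
Implicit Types (U V W A B : set G) (g x y : G) (s t : seq G).

(* [s] lists representatives of distinct right cosets [V x]. *)
Definition separated V s := pairwise (fun x y => (y / x)%g \notin V) s.

Definition packing V A s :=
  separated V s /\ forall x, x \in s -> forall v, V v -> A (v * x)%g.

Definition covering V A s := forall a, A a -> exists2 x, x \in s & V (a / x)%g.

Definition transversal V A s := packing V A s /\ covering V A s.

Lemma packing_sub V A B s : A `<=` B -> packing V A s -> packing V B s.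
Proof. by move=> AB [sep As]; split => // x xs v Vv; apply: AB; exact: As. Qed.

Lemma separated_inj V s : is_subgroup V -> separated V s ->
  {in s &, forall x y, V (x / y)%g -> x = y}.
Proof.
move=> sV; elim: s => [//|z s IH] /= /andP[/allP zs sep] x y; rewrite !inE.
case/orP => [/eqP->|xs] /orP[/eqP->//|ys].
- move=> Vzy; have := zs y ys; rewrite -invgF => /negP[].
  by apply/mem_set; exact: subgroupV.
- by move=> Vxz; have := zs x xs => /negP[]; exact/mem_set.
- exact: IH.
Qed.

Lemma separated_uniq V s : is_subgroup V -> separated V s -> uniq s.
Proof.
move=> sV; elim: s => [//|z s IH] /= /andP[/allP zs sep]; rewrite IH// andbT.
apply/negP => /zs /negP[]; apply/mem_set; rewrite mulgV; exact: subgroup1.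
Qed.

Lemma uniq_separated V s : is_subgroup V -> uniq s ->
  {in s &, forall x y, V (x / y)%g -> x = y} -> separated V s.
Proof.
move=> sV; elim: s => [//|z s IH] /= /andP[zs us] inj; apply/andP; split.
  apply/allP => y ys; apply/negP => /set_mem /inj yz; move: zs.
  by rewrite -yz ?ys// inE ?eqxx// ys orbT.
by apply: IH => // x y xs ys; apply: inj; rewrite inE ?xs ?ys orbT.
Qed.

Lemma packing_size V A s t : is_subgroup V -> packing V A s -> covering V A t ->
  (size s <= size t)%N.
Proof.
move=> sV [sep As] At.
have h x : exists y, x \in s -> y \in t /\ V (x / y)%g.
  have [xs|xs] := boolP (x \in s); last by exists x.
  have := As x xs 1%g (subgroup1 sV); rewrite mul1g => /At[y yt Vxy].
  by exists y.
pose f x := sval (cid (h x)).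
have fP x : x \in s -> f x \in t /\ V (x / f x)%g by rewrite /f; case: cid.
rewrite -(size_map f s); apply: uniq_leq_size.
  rewrite map_inj_in_uniq ?(separated_uniq sV sep)// => x y xs ys fxy.
  apply: (separated_inj sV sep) => //.
  have [_ Vx] := fP x xs; have [_ Vy] := fP y ys.
  by rewrite -(mulgKA (f x)^-1%g) {2}fxy; exact: sV.2.
by move=> _ /mapP[x xs ->]; case: (fP x xs).
Qed.

Lemma covering_exists V A : is_subgroup V -> open V -> compact A ->
  exists t, covering V A t.
Proof.
move=> sV oV cA.
have cA' : compact [set a^-1%g | a in A].
  by apply: compact_image => //; exact: invg_continuous.
have [t [tA tc]] := compact_finite_cosets sV oV cA'.
exists (map (fun x => x^-1%g) t) => a Aa.
have [|y yt Vy] := tc a^-1%g; first by exists a.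
exists y^-1%g; first exact: map_f.
by rewrite invgK -[(a * y)%g]invgK invgM; exact: subgroupV.
Qed.

(** Sizes of packings are bounded by that of a finite covering, and a packing of maximal size
    covers. *)
Lemma transversal_exists V A : is_subgroup V -> open V -> compact A ->
  (forall v a, V v -> A a -> A (v * a)%g) -> exists s, transversal V A s.
Proof.
move=> sV oV cA VA.
have [t tP] := covering_exists sV oV cA.
have [] := @ex_maxnP (fun n => `[< exists2 s, packing V A s & size s = n >]) (size t).
- by exists 0%N; apply/asboolP; exists [::].
- by move=> n /asboolP[s ps <-]; exact: packing_size sV ps tP.
move=> n /asboolP[s [sep As] <-] smax; exists s; split => // a Aa.
apply: contrapT => nas; have : ((size s).+1 <= size s)%N; last by rewrite ltnn.
apply: smax; apply/asboolP; exists (a :: s) => //; split.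
  apply/andP; split => //; apply/allP => x xs; apply/negP => /set_mem Vxa.
  by apply: nas; exists x => //; rewrite -invgF; exact: subgroupV.
by move=> x; rewrite inE => /orP[/eqP->|xs] v Vv; [exact: VA|exact: As].
Qed.

Definition refine s t := [seq (y * x)%g | x <- s, y <- t].

Lemma size_refine s t : size (refine s t) = (size s * size t)%N.
Proof. exact: size_allpairs. Qed.

Lemma packing_refine W V A s t : is_subgroup V -> is_subgroup W -> W `<=` V ->
  packing V A s -> packing W V t -> packing W A (refine s t).
Proof.
move=> sV sW WV [seps As] [sept Vt].
have tV y : y \in t -> V y by move=> /Vt /(_ _ (subgroup1 sW)); rewrite mul1g.
have inj : {in s & t, forall x y, {in s & t, forall x' y', W ((y * x) / (y' * x'))%g ->
  x = x' /\ y = y'}}.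
  move=> x y xs yt x' y' xs' yt' Wq.
  have xx' : x = x'.
    apply: (separated_inj sV seps) => //.
    have -> : (x / x' = y^-1 * (y * x / (y' * x')) * y')%g.
      by rewrite invgM !mulgA mulgVK mulVg mul1g.
    by apply: (subgroupM sV (subgroupM sV (subgroupV sV (tV _ yt)) (WV _ Wq))); exact: tV.
  split=> //; apply: (separated_inj sW sept) => //.
  by move: Wq; rewrite xx' mulgKA.
split.
  apply: uniq_separated => //.
    apply: allpairs_uniq; [exact: separated_uniq sV seps|exact: separated_uniq sW sept|].
    move=> /= _ _ /allpairsP[[x y] /= [xs yt ->]] /allpairsP[[x' y'] /= [xs' yt' ->]]
      /= e.
    have [|-> ->//] := inj x y xs yt x' y' xs' yt'.
    by rewrite e mulgV; exact: subgroup1.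
  move=> _ _ /allpairsP[[x y] /= [xs yt ->]] /allpairsP[[x' y'] /= [xs' yt' ->]] h.
  by have [-> ->] := inj x y xs yt x' y' xs' yt' h.
move=> _ /allpairsP[[x y] /= [xs yt ->]] w Ww.
by rewrite mulgA; apply: As => //; exact: Vt.
Qed.

(** Multiplicativity of the index. *)
Lemma transversal_refine W V A s t : is_subgroup V -> is_subgroup W -> W `<=` V ->
  transversal V A s -> transversal W V t -> transversal W A (refine s t).
Proof.
move=> sV sW WV [ps cs] [pt ct]; split; first exact: packing_refine ps pt.
move=> a /cs[x xs /ct[y yt Wy]]; exists (y * x)%g; first exact: allpairs_f.
by rewrite invgM mulgA.
Qed.

Lemma packing_cat V A B s t : is_subgroup V -> A `&` B = set0 ->
  packing V A s -> packing V B t -> packing V (A `|` B) (s ++ t).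
Proof.
move=> sV AB0 [seps As] [sept Bt]; split; last first.
  by move=> x; rewrite mem_cat => /orP[xs|xt] v Vv; [left; exact: As|right; exact: Bt].
rewrite /separated pairwise_cat; apply/and3P; split => //; apply/allrelP => x y xs yt.
apply/negP => /set_mem Vyx; have : set0 y; last by [].
rewrite -AB0; split; first by rewrite -(mulgVK x y); exact: As.
by rewrite -[y]mul1g; apply: Bt => //; exact: subgroup1.
Qed.

Lemma packing_translate V A s g : packing V A s ->
  packing V (right_translate A g) [seq (x * g)%g | x <- s].
Proof.
move=> [sep As]; split.
  rewrite /separated pairwise_map; apply: sub_pairwise sep => x y /=.
  by rewrite mulgKA.
by move=> _ /mapP[x xs ->] v Vv; exists (v * x)%g; [exact: As|rewrite mulgA].
Qed.

End Packings.

Lemma ereal_sup_add_le (R : realType) (S : set (\bar R)) (c d : \bar R) :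
  S !=set0 -> (0 <= c)%E -> (forall x, S x -> (0 <= x)%E) ->
  (forall x, S x -> (x + c <= d)%E) -> (ereal_sup S + c <= d)%E.
Proof.
move=> [x Sx] c0 S0 Sd; have [cy|cy] := eqVneq c +oo%E.
  have := Sd x Sx; rewrite cy addey ?leye_eq => [/eqP->|]; first by rewrite leey.
  by rewrite -ltNye (lt_le_trans _ (S0 x Sx)).
have fc : c \is a fin_num by rewrite ge0_fin_numE// ltey.
by rewrite -leeBrDr//; apply: ge_ereal_sup => y /Sd; rewrite leeBrDr.
Qed.

(** * The content obtained by counting cosets *)

Section HaarContent.
Variables (R : realType) (G : topGroupType) (U0 : set G).
Hypotheses (vG : van_dantzig G) (cU0 : compact_open_subgroup U0).
Implicit Types (U V W A B : set G) (g x y : G) (s t : seq G).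

Definition small_subgroup V := compact_open_subgroup V /\ V `<=` U0.

Definition coset_index V : nat := get [set n | exists2 s, transversal V U0 s & size s =
  n].

Lemma small_transversal V U : compact_open_subgroup V -> compact_open_subgroup U ->
  V `<=` U -> exists t, transversal V U t.
Proof.
move=> [sV _ oV] [sU kU _] VU; apply: transversal_exists => // v a Vv Ua.
by apply: (subgroupM sU) => //; exact: VU.
Qed.

Lemma coset_indexE V s : is_subgroup V -> transversal V U0 s -> coset_index V = size s.
Proof.
move=> sV ts; rewrite /coset_index; apply: get_unique; first by exists s.
move=> n [t tt <-]; apply/eqP; rewrite eqn_leq.
have [ps cs] := ts; have [pt ct] := tt.
by rewrite (packing_size sV ps ct) (packing_size sV pt cs).
Qed.

Lemma coset_index_gt0 V : small_subgroup V -> (0 < coset_index V)%N.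
Proof.
move=> [cV VU]; have [t tt] := small_transversal cV cU0 VU; have [sV _ _] := cV.
rewrite (coset_indexE sV tt); case: t tt => // -[_ c].
by have [] := c _ (subgroup1 (let: And3 s _ _ := cU0 in s)).
Qed.

Lemma small_subgroupI V W : small_subgroup V -> small_subgroup W -> small_subgroup (V
  `&` W).
Proof. by move=> [cV VU] [cW _]; split=> [|x [/VU]//]; exact: compact_open_subgroupI. Qed.

Definition packing_value V s : R := (size s)%:R / (coset_index V)%:R.

Lemma packing_value_ge0 V s : 0 <= packing_value V s.
Proof. by rewrite divr_ge0. Qed.

(** Refinement multiplies the number of cosets and the index in [U0] by the same factor, the index
    of [W] in [V]. Packings by different subgroups thereby become comparable. *)
Lemma packing_value_refine V W A s : small_subgroup V -> small_subgroup W -> W `<=` V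
  -> packing V A s ->
  exists2 t, transversal W V t & packing W A (refine s t) /\ packing_value W (refine s
    t) = packing_value V s.
Proof.
move=> hV hW WV ps; have [cV VU] := hV; have [cW WU] := hW.
have [sV _ _] := cV; have [sW _ _] := cW.
have [t tt] := small_transversal cW cV WV; exists t => //.
split; first exact: packing_refine ps tt.1.
have [u tu] := small_transversal cV cU0 VU.
have := coset_indexE sW (transversal_refine sV sW WV tu tt).
rewrite size_refine -(coset_indexE sV tu) /packing_value size_refine => iW.
have := coset_index_gt0 hV; have := coset_index_gt0 hW;
  rewrite iW muln_gt0 => /andP[i0 t0] _.
by rewrite !natrM -mulf_div divff ?mulr1// pnatr_eq0 -lt0n.
Qed.

Definition packing_values A : set (\bar R) :=
  [set r | exists V s, [/\ small_subgroup V, packing V A s & r = (packing_value V s)%:E]].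

(* A set [A] is approximated from inside by unions of right cosets of compact open
   subgroups [V] of [U0], each of measure one over the index of [V] in [U0]. *)
Definition content A : \bar R := ereal_sup (packing_values A).

Lemma small_subgroup_U0 : small_subgroup U0. Proof. by split. Qed.

Lemma packing_values0 A : packing_values A 0%E.
Proof.
exists U0, [::]; split => //; first exact: small_subgroup_U0.
by rewrite /packing_value mul0r.
Qed.

Lemma content_ge0 A : (0 <= content A)%E.
Proof. exact: ereal_sup_ubound (packing_values0 A). Qed.

Lemma content_value A V s : small_subgroup V -> packing V A s -> ((packing_value V
  s)%:E <= content A)%E.
Proof. by move=> hV ps; apply: ereal_sup_ubound; exists V, s. Qed.

Lemma content_sub A B : A `<=` B -> (content A <= content B)%E.
Proof.
move=> AB; apply: ereal_sup_le => _ [V [s [hV ps ->]]].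
by exists V, s; split => //; exact: packing_sub ps.
Qed.

Lemma content0 : content set0 = 0%E.
Proof.
apply/eqP; rewrite eq_le content_ge0 andbT; apply: ge_ereal_sup.
move=> _ [V [[|x s] [[[sV _ _] _] [_ ps] ->]]]; first by rewrite /packing_value mul0r.
by have := ps x (mem_head _ _) 1%g (subgroup1 sV).
Qed.

Lemma content_superadditive A B : A `&` B = set0 ->
  (content A + content B <= content (A `|` B))%E.
Proof.
move=> AB0; apply: ereal_sup_add_le.
- by exists 0%E; exact: packing_values0.
- exact: content_ge0.
- by move=> _ [V [s [_ _ ->]]]; rewrite lee_fin packing_value_ge0.
move=> _ [V [s [hV ps ->]]]; rewrite addeC; apply: ereal_sup_add_le.
- by exists 0%E; exact: packing_values0.
- by rewrite lee_fin packing_value_ge0.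
- by move=> _ [W [t [_ _ ->]]]; rewrite lee_fin packing_value_ge0.
move=> _ [W [t [hW pt ->]]].
have hVW := small_subgroupI hV hW.
have [s' _ [ps' <-]] := packing_value_refine hV hVW (@subIsetl _ _ _) ps.
have [t' _ [pt' <-]] := packing_value_refine hW hVW (@subIsetr _ _ _) pt.
rewrite -EFinD addrC /packing_value -mulrDl -natrD -size_cat.
apply: content_value => //; apply: packing_cat => //.
by case: hVW => -[].
Qed.

Lemma content_translate A g : content (right_translate A g) = content A.
Proof.
have le B h : (content B <= content (right_translate B h))%E.
  apply: ereal_sup_le => _ [V [s [hV ps ->]]].
  exists V, [seq (x * h)%g | x <- s].
  by rewrite /packing_value size_map; split => //; exact: packing_translate.
apply/eqP; rewrite eq_le le andbT.
apply: (le_trans (le _ g^-1%g)); apply: content_sub.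
by move=> _ [_ [x Ax <-] <-]; rewrite mulgK.
Qed.

Lemma content_U0 : content U0 = 1%E.
Proof.
have [sU kU oU] := cU0.
have tU : transversal U0 U0 [:: 1%g].
  split; first by split => // x; rewrite inE => /eqP-> v Uv; rewrite mulg1.
  by move=> a Ua; exists 1%g; rewrite ?inE// divg1.
apply/eqP; rewrite eq_le; apply/andP; split; last first.
  have := content_value small_subgroup_U0 tU.1.
  by rewrite /packing_value (coset_indexE sU tU) divr1.
apply: ge_ereal_sup => _ [V [s [hV ps ->]]]; have [cV VU] := hV.
have [sV _ _] := cV; have [t tt] := small_transversal cV cU0 VU.
rewrite lee_fin /packing_value ler_pdivrMr ?ltr0n ?coset_index_gt0// mul1r ler_nat
  (coset_indexE sV tt).
exact: packing_size sV ps tt.2.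
Qed.

Definition saturation V s : set G := [set y | exists2 x, x \in s & V (y / x)%g].

Lemma saturation_open V s : open V -> open (saturation V s).
Proof.
move=> oV; have -> : saturation V s = \bigcup_(x in [set` s]) [set y | V (y / x)%g].
  by apply/seteqP; split => y [x]; exists x.
by apply: bigcup_open => x _; exact: open_rmul.
Qed.

Lemma saturation_compact V s : compact V -> compact (saturation V s).
Proof.
move=> kV; elim: s => [|z s IH].
  by rewrite (_ : saturation V [::] = set0); [exact: compact0|apply/seteqP;
    split => // y [x]].
rewrite (_ : saturation V (z :: s) = [set (v * z)%g | v in V] `|` saturation V s).
  by apply: compactU => //; apply: compact_image => //; exact: continuous_rmul.
apply/seteqP; split => y.
  move=> [x]; rewrite inE => /orP[/eqP->|xs] Vyx; last by right; exists x.
  by left; exists (y / z)%g => //; rewrite mulgVK.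
move=> [[v Vv <-]|[x xs Vyx]]; first by exists z; rewrite ?mem_head// mulgK.
by exists x => //; rewrite inE xs orbT.
Qed.

Lemma saturation_sub V s A : packing V A s -> saturation V s `<=` A.
Proof. by move=> [_ As] y [x xs Vyx]; rewrite -(mulgVK x y); exact: As. Qed.

Lemma packing_saturation V s A : packing V A s -> packing V (saturation V s) s.
Proof. by move=> [sep As]; split => // x xs v Vv; exists x => //; rewrite mulgK. Qed.

(* Lebesgue number: by compactness all cosets of some small [W] in a saturated set lie
   in a member of the cover. *)
Lemma content_subadditive (F : (set G)^nat) : (forall n, open (F n)) ->
  (content (\bigcup_n F n) <= \sum_(n <oo) content (F n))%E.
Proof.
move=> oF; apply: ge_ereal_sup => _ [V [s [hV ps ->]]].
have [cV VU] := hV; have [sV kV oV] := cV.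
have [W hW [WV WF]] : exists2 W, small_subgroup W & W `<=` V /\
    forall y, saturation V s y -> exists n, forall w, W w -> F n (w * y)%g.
  pose D := [set N : set G | nbhs 1%g N].
  (* Along [H] the sets [W] shrink to the unit. *)
  pose H := filter_from D (fun N => [set W : set G | W `<=` N]).
  have FH : Filter H.
    apply: filter_from_filter; first by exists setT; exact: filterT.
    move=> N N' nN nN'; exists (N `&` N'); first exact: filterI.
    by move=> W WN; split=> x /WN[].
  have /compact_near_coveringP/(_ _ H (fun W y => exists n, forall w, W w -> F n (w *
    y)%g) FH) :=
    saturation_compact (s := s) kV.
  case=> [y Ky|N nN HN].
    have [n _ Fny] := saturation_sub ps Ky.
    have c : continuous (fun p : G * G => (p.2 * p.1)%g).
      by apply: continuous_mulg => ?; [exact: cvg_snd|exact: cvg_fst].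
    have := c (y, 1%g) (F n); rewrite /= mul1g => /(_ (open_nbhs_nbhs (conj (oF n) Fny))).
    move=> [[A B] /= [nA nB] AB]; exists (A, [set W | W `<=` B]).
      by split => //; exists B.
    by move=> [y' W'] /= [Ay' W'B]; exists n => w /W'B Bw; exact: (AB (y', w)).
  have nNV : nbhs (1%g : G) (N `&` V).
    by apply: filterI => //; apply: open_nbhs_nbhs; split => //; exact: subgroup1.
  have [W cW WNV] := vG.2 _ nNV.
  exists W; first by split => // x /WNV[_ /VU].
  by split; [move=> x /WNV[]|apply: HN => x /WNV[]].
have [sW _ _] := hW.1.
have [t tt [pt <-]] := packing_value_refine hV hW WV (packing_saturation ps).
set u := refine s t in pt *.
have uK x : x \in u -> saturation V s x.
  by move=> xu; rewrite -[x]mul1g; apply: pt.2 => //; exact: subgroup1.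
have [f fP] : {f : G -> nat & forall x, x \in u -> forall w, W w -> F (f x) (w * x)%g}.
  apply: (@choice _ _ (fun x n => x \in u -> forall w, W w -> F n (w * x)%g)) => x.
  have [xu|xu] := boolP (x \in u); last by exists 0%N.
  by have [n Hn] := WF x (uK x xu); exists n.
pose N := (\max_(x <- u) f x).+1.
(* The cosets are sorted by the member of the cover chosen for them; each class is a packing of a
   single [F n]. *)
have uN : (packing_value W u)%:E = (\sum_(n < N) (packing_value W [seq x <- u | f x ==
  n])%:E)%E.
  rewrite sumEFin /packing_value -mulr_suml -natr_sum; congr ((_%:R / _)%:E).
  rewrite -sum1_size (partition_big (fun x => inord (f x) : 'I_N) xpredT)//=.
  apply: eq_bigr => i _; rewrite -sum1_size big_filter.
  rewrite big_seq_cond [RHS]big_seq_cond; apply: eq_bigl => x.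
  case xu : (x \in u) => //=; rewrite -val_eqE /= inordK//.
  by rewrite ltnS; apply: leq_bigmax_seq.
rewrite uN; apply: (@le_trans _ _ (\sum_(n < N) content (F n))%E).
  apply: lee_sum => n _; apply: content_value => //; split.
    have [sep _] := pt; apply: uniq_separated => //.
      by rewrite filter_uniq// (separated_uniq sW sep).
    by move=> x y; rewrite !mem_filter => /andP[_ xu] /andP[_ yu];
      exact: (separated_inj sW sep).
  by move=> x; rewrite mem_filter => /andP[/eqP <- xu] v Wv; exact: fP.
rewrite -(big_mkord xpredT (fun n => content (F n))); apply: nneseries_lim_ge => n _ _.
exact: content_ge0.
Qed.

End HaarContent.

(** * The outer measure induced by the content *)

Section HaarMeasure.
Variables (R : realType) (G : topGroupType) (U0 : set G).
Hypotheses (vG : van_dantzig G) (cU0 : compact_open_subgroup U0).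
Implicit Types (U V W A B : set G) (g x y : G) (s t : seq G).

Local Notation lam := (@content R G U0).

(** Outer regularity is built in; inner regularity on open sets comes from [content], because the
    saturation of a packing is compact. *)
Definition haar A : \bar R := ereal_inf [set lam O | O in [set O | open O /\ A `<=` O]].

Lemma haar_le_content A (O : set G) : open O -> A `<=` O -> (haar A <= lam O)%E.
Proof. by move=> oO AO; apply: ereal_inf_lbound; exists O. Qed.

Lemma haar_open (O : set G) : open O -> haar O = lam O.
Proof.
move=> oO; apply/eqP; rewrite eq_le haar_le_content//=.
by apply: le_ereal_inf_tmp => _ [P [oP OP] <-]; exact: content_sub.
Qed.

Lemma haar_ge0 A : (0 <= haar A)%E.
Proof. by apply: le_ereal_inf_tmp => _ [P _ <-]; exact: content_ge0. Qed.

Lemma haar0 : haar set0 = 0%E.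
Proof. by rewrite haar_open ?content0//; exact: open0. Qed.

Lemma haar_sub A B : A `<=` B -> (haar A <= haar B)%E.
Proof.
move=> AB; apply: le_ereal_inf_tmp => _ [P [oP BP] <-].
by apply: haar_le_content => //; exact: subset_trans BP.
Qed.

Lemma haar_sigma_subadditive : sigma_subadditive haar.
Proof.
move=> A; have [[i ioo]|] := pselect (exists i, haar (A i) = +oo%E).
  rewrite (eseries_pinfty _ _ ioo) ?leey// => n _.
  by rewrite -ltNye (lt_le_trans _ (haar_ge0 _)).
rewrite -forallNE => Aoo.
apply/lee_addgt0Pr => e e0.
rewrite (le_trans _ (epsilon_trick _ _ (ltW e0)))//; last by move=> n; exact: haar_ge0.
pose P n (O : set G) := [/\ open O, A n `<=` O &
  (lam O <= haar (A n) + (e / (2 ^ n.+1)%:R)%:E)%E].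
have [Q PO] : {Q : (set G)^nat & forall n, P n (Q n)}.
  apply: (@choice _ _ P) => n.
  have en : 0 < e / (2 ^ n.+1)%:R :> R by rewrite divr_gt0// ltr0n expn_gt0.
  have fA : haar (A n) \is a fin_num.
    by rewrite ge0_fin_numE ?haar_ge0// ltey; apply/eqP.
  have [_ [B [oB AB] <-] lB] := lb_ereal_inf_adherent en fA.
  by exists B; split => //; exact: ltW.
apply: (@le_trans _ _ (lam (\bigcup_n Q n))).
  apply: haar_le_content; first by apply: bigcup_open => n _; have [] := PO n.
  by apply: subset_bigcup => n _; have [] := PO n.
apply: (le_trans (content_subadditive R vG cU0 _)); first by move=> n; have [] := PO n.
apply: lee_nneseries => n _; first by move=> _; exact: content_ge0.
by have [] := PO n.
Qed.

(** Take an open [P] around the test set [X] and a packing of the intersection of [P] and [O]. Its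
    saturation is closed, so the rest of [P] is open and contains the part of [X] outside [O];
    superadditivity of the content concludes. *)
Lemma haar_open_caratheodory (O : set G) : open O -> caratheodory_measurable haar O.
Proof.
move=> oO.
pose mu : {outer_measure set G -> \bar R} := HB.pack haar
  (isOuterMeasure.Build R G haar haar0 haar_ge0 haar_sub haar_sigma_subadditive).
apply: (@le_caratheodory_measurable R G mu) => X /=.
apply: le_ereal_inf_tmp => _ [P [oP XP] <-].
apply: (@le_trans _ _ (lam (P `&` O) + haar (X `&` ~` O))%E).
  by apply: leeD => //; apply: haar_le_content; [exact: openI|exact: setSI].
apply: ereal_sup_add_le.
- by exists 0%E; exact: packing_values0.
- exact: haar_ge0.
- by move=> _ [V [s [_ _ ->]]]; rewrite lee_fin packing_value_ge0.
move=> _ [V [s [hV ps ->]]]; have [[sV kV oV] VU] := hV.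
have sat := saturation_sub ps.
have clK : closed (saturation V s).
  by apply: compact_closed; [exact: vG.1|exact: saturation_compact].
apply: (@le_trans _ _ (lam (saturation V s) + lam (P `\` saturation V s))%E).
  apply: leeD; first by apply: content_value => //; exact: (packing_saturation ps).
  apply: haar_le_content; first by rewrite setDE; apply: openI => //; exact: closed_openC.
  by move=> x [/XP Px nOx]; split => // /sat[].
apply: le_trans (content_superadditive R cU0 _) _; first by rewrite setDIK.
by apply: content_sub => x [/sat[]|[]].
Qed.

End HaarMeasure.

Section HaarExistence.
Variables (R : realType) (G : topGroupType).
Implicit Types (U V W A B : set G) (g x y : G).

Lemma right_translateE A g : right_translate A g = [set x | A (x / g)%g].
Proof.
apply/seteqP; split => x; first by move=> [a Aa <-]; rewrite /= mulgK.
by move=> Ax; exists (x / g)%g => //; rewrite mulgVK.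
Qed.

Lemma open_right_translate A g : open A -> open (right_translate A g).
Proof. by move=> oA; rewrite right_translateE; exact: open_rmul. Qed.

Lemma haar_translate U0 A g : haar R U0 (right_translate A g) = haar R U0 A.
Proof.
have le B h : (haar R U0 (right_translate B h) <= haar R U0 B)%E.
  apply: le_ereal_inf_tmp => _ [P [oP BP] <-]; rewrite -(content_translate R U0 P h).
  apply: haar_le_content; first exact: open_right_translate.
  by move=> _ [b Bb <-]; exists b => //; exact: BP.
apply/eqP; rewrite eq_le le /=.
have {1}-> : A = right_translate (right_translate A g) g^-1%g.
  by rewrite !right_translateE; apply/seteqP; split => x /=; rewrite invgK mulgK.
exact: le.
Qed.

(** Needed because [modular] is a choice from a set that must be shown inhabited. Compact sets have
    finite measure since finitely many translates of [U0], each of measure one, cover them. *)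
Theorem right_haar_exists : van_dantzig G ->
  exists mu : {measure set (borel_type G) -> \bar R}, right_haar mu.
Proof.
move=> vG; have [U0 cU0 _] := vG.2 setT filterT.
have [sU kU oU] := cU0.
pose out : {outer_measure set (pointed_group G) -> \bar R} := HB.pack (haar R U0)
  (isOuterMeasure.Build R G (haar R U0) (haar0 R cU0) (haar_ge0 R cU0)
     (@haar_sub R G U0) (haar_sigma_subadditive R vG cU0)).
have cara (A : set (borel_type G)) : measurable A -> caratheodory_measurable out A.
  apply: smallest_sub => [|O oO]; last exact: haar_open_caratheodory.
  split; first exact: caratheodory_measurable_set0.
  - by move=> B mB; rewrite setTD; exact: caratheodory_measurable_setC.
  - by move=> B mB; exact: caratheodory_measurable_bigcup.
have hsa : semi_sigma_additive (haar R U0 : set (borel_type G) -> \bar R).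
  move=> F mF tF mUF; apply: (@caratheodory_measure_sigma_additive R (pointed_group G)
    out) => //.
    by move=> i; exact: cara.
  exact: cara.
pose mu : {measure set (borel_type G) -> \bar R} := HB.pack
  (haar R U0 : set (borel_type G) -> \bar R)
  (isMeasure.Build _ (borel_type G) R (haar R U0) (haar0 R cU0) (haar_ge0 R cU0) hsa).
exists mu; split.
- rewrite gt_eqF//= haar_open; last exact: openT.
  apply: lt_le_trans (content_sub R _ (@subsetT _ U0)).
  by rewrite content_U0// lte01.
- move=> K kK /=.
  have [t [_ tc]] := compact_finite_cosets sU oU (compact_image (@invg_continuous G) kK).
  have KU : K `<=` \big[setU/set0]_(x <- t) right_translate U0 x^-1%g.
    move=> x Kx; have [|y yt Uy] := tc x^-1%g; first by exists x.
    rewrite -bigcup_seq; exists y => //=; rewrite right_translateE /= invgK.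
    by rewrite -[(x * y)%g]invgK invgM; exact: subgroupV.
  apply: le_lt_trans (haar_sub R U0 KU) _.
  apply: (@le_lt_trans _ _ (\sum_(x <- t) haar R U0 (right_translate U0 x^-1%g))%E).
    elim: t {tc KU} => [|x t IH]; first by rewrite !big_nil haar0.
    rewrite !big_cons; apply: le_trans (leeD (lexx _) IH).
    exact: (outer_measureU2 out).
  rewrite (eq_bigr (fun=> 1%E)) => [|x _]; last by rewrite haar_translate haar_open
    ?content_U0.
  by rewrite sumEFin ltry.
- move=> A mA /=; rewrite {1}/haar; congr ereal_inf.
  apply/seteqP; split => _ [P [oP AP] <-]; exists P => //; by rewrite haar_open.
- move=> O oO /=; apply/eqP; rewrite eq_le; apply/andP; split; last first.
    by apply: ge_ereal_sup => _ [K [_ KO] <-]; exact: haar_sub.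
  rewrite haar_open//; apply: ge_ereal_sup => _ [V [s [hV ps ->]]].
  have [[sV kV oV] VU] := hV.
  apply: (@le_trans _ _ (haar R U0 (saturation V s))).
    rewrite haar_open; last exact: saturation_open.
    by apply: content_value => //; exact: (packing_saturation ps).
  apply: ereal_sup_ubound; exists (saturation V s) => //; split.
    exact: saturation_compact.
  exact: saturation_sub ps.
- by move=> A g mA /=; exact: haar_translate.
Qed.

End HaarExistence.

(** * Scale and modular function *)

Section Scale.
Variable G : topGroupType.
Implicit Types (U V W : set G) (g x y : G).

Lemma conjugateE g U : conjugate g U = [set x | U (g^-1 * x * g)%g].
Proof.
apply/seteqP; split => x /=.
  by move=> [u Uu <-]; rewrite !mulgA mulgVK mulVg mul1g.
by move=> Ux; exists (g^-1 * x * g)%g => //; rewrite !mulgA mulgV mul1g mulgK.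
Qed.

Lemma is_subgroup_conjugate g U : is_subgroup U -> is_subgroup (conjugate g U).
Proof.
move=> [U1 UD]; rewrite conjugateE; split; first by rewrite /= mulg1 mulVg.
move=> x y /= Ux Uy.
have -> : (g^-1 * (x / y) * g = (g^-1 * x * g) / (g^-1 * y * g))%g.
  by rewrite mulgKA invgM invgK !mulgA.
exact: UD.
Qed.

Lemma scale_values1 g : scale_values g 1%N <->
  exists2 U, compact_open_subgroup U & conjugate g U `<=` U.
Proof.
split=> -[U cU]; have [sU _ _] := cU => h; exists U => //; last first.
  rewrite /has_index (_ : [set _ | _ in _] = [set conjugate g U]); first exact: card_set1.
  have sC := is_subgroup_conjugate g sU.
  rewrite (setIidr h); apply/seteqP; split => [_ [c Cc <-]|_ ->].
    apply/seteqP; split => [_ [c' Cc' <-]|x Cx]; first exact: subgroupM.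
    exists (c^-1 * x)%g; last by rewrite mulVKg.
    exact: (subgroupM sC (subgroupV sC Cc)).
  exists 1%g; first exact: subgroup1.
  by apply/seteqP; split => [_ [c' Cc' <-]|x Cx]; [rewrite mul1g|exists x;
    rewrite ?mul1g].
move=> c Cc; have sC := is_subgroup_conjugate g sU.
move: h; rewrite /has_index => /eq_cardSP[S _]; rewrite II0 card_eq0 => /eqP S0.
set B := U `&` conjugate g U in S0.
have inS z : conjugate g U z -> left_translate z B = S.
  move=> Cz; apply: contrapT => zS.
  have : set0 (left_translate z B); last by [].
  by rewrite -S0; split => //; exists z.
have : left_translate c B c by exists 1%g; [split; exact: subgroup1|rewrite mulg1].
rewrite (inS c Cc) -(inS 1%g (subgroup1 sC)) => -[b [Ub _]].
by rewrite mul1g => <-.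
Qed.

(** Indices are positive, so the value one is minimal once attained. Conversely, [get] returns 0 on
    an empty set, so scale one is never a default value. *)
Lemma scale_eq1 g : scale g = 1%N <->
  exists2 U, compact_open_subgroup U & conjugate g U `<=` U.
Proof.
rewrite -scale_values1 /scale; set P := [set n | _].
have P0 n : P n -> (0 < n)%N.
  rewrite lt0n; case=> -[U [sU _ _]] + _; apply: contraPN => /eqP->.
  rewrite /has_index II0 card_eq0 => /eqP h.
  have : [set left_translate a (U `&` conjugate g U) | a in conjugate g U]
      (left_translate 1%g (U `&` conjugate g U)).
    exists 1%g => //; exact: subgroup1 (is_subgroup_conjugate g sU).
  by rewrite h.
split=> [e|v1].
  have [[n Pn]|nP] := pselect (exists n, P n).
    have : P (get P) by apply: getPex; exists n.
    by rewrite e => -[].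
  by move: e; rewrite getPN// => n Pn; apply: nP; exists n.
have P1 : P 1%N.
  split=> // m vm; rewrite lt0n; apply/eqP => m0.
  have : P 0%N by split => //; rewrite -m0.
  by move/P0.
apply: get_unique => // n Pn; apply/eqP; rewrite eqn_leq P0// andbT.
by case: Pn => _; apply.
Qed.

End Scale.

(** * Haar measure of translates and conjugates *)

Section Modular.
Variables (R : realType) (G : topGroupType).
Implicit Types (U V W A : set G) (g x y : G).

Lemma open_left_translate A g : open A -> open (left_translate g A).
Proof.
move=> oA; rewrite (_ : left_translate g A = [set x | A (g^-1 * x)%g]).
  exact: open_lmul.
apply/seteqP; split => x; first by move=> [u Au <-]; rewrite /= mulKg.
by move=> Ax; exists (g^-1 * x)%g => //; rewrite mulVKg.
Qed.

Lemma borel_open A : open A -> measurable (A : set (borel_type G)).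
Proof. by move=> oA; apply: sub_sigma_algebra. Qed.

Lemma borel_right_translate A g : open A ->
  measurable (right_translate A g : set (borel_type G)).
Proof. by move=> oA; exact: borel_open (open_right_translate g oA). Qed.

Variable mu : {measure set (borel_type G) -> \bar R}.
Hypotheses (hmu : right_haar mu) (hG : hausdorff_space G).

Lemma haar_right_translate A g : open A -> mu (right_translate A g) = mu A.
Proof. by move=> oA; case: hmu => _ _ _ _; apply; exact: borel_open. Qed.

Lemma haar_fin A : compact A -> (mu A < +oo)%E.
Proof. by case: hmu => _ + _ _ _; apply. Qed.

Lemma haar_conjugate U g : open U -> mu (conjugate g U) = mu (left_translate g U).
Proof.
move=> oU; rewrite -(haar_right_translate g^-1%g (open_left_translate g oU)).
congr (mu _); apply/seteqP; split => x.
  by move=> [u Uu <-]; exists (g * u)%g => //; exists u.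
by move=> [_ [u Uu <-] <-]; exists u.
Qed.

(* The right translates [g V x], [x] in [t], partition [g A]. *)
Lemma haar_left_translate_transversal V A g t : is_subgroup V -> open V ->
  transversal V A t ->
  mu (left_translate g A) = ((size t)%:R%:E * mu (left_translate g V))%E.
Proof.
move=> sV oV [pt ct].
have -> : left_translate g A = \big[setU/set0]_(x <- t) right_translate (left_translate
  g V) x.
  rewrite -bigcup_seq; apply/seteqP; split => y.
    move=> [u /ct[x xt Vux] <-]; exists x => //=; exists (g * (u / x))%g.
      by exists (u / x)%g.
    by rewrite -mulgA mulgVK.
  move=> [x xt [_ [v Vv <-] <-]]; exists (v * x)%g; last by rewrite mulgA.
  exact: pt.2.
have {ct pt} := pt.1; have ogV := open_left_translate g oV.
elim: t => [|x t IH] /=; first by rewrite big_nil measure0 mul0e.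
move=> /andP[/allP xt sep]; rewrite big_cons measureU.
- rewrite [X in (X + _)%E](haar_right_translate x ogV) [X in (_ + X)%E](IH sep).
  by rewrite -nat1r EFinD ge0_muleDl ?mul1e// lee_fin.
- exact: borel_right_translate.
- apply: bigsetU_measurable => y _; exact: borel_right_translate.
- rewrite -bigcup_seq; apply/seteqP; split => // z [[_ [v Vv <-] <-]].
  move=> [y yt [_ [w Vw <-]]]; rewrite -!mulgA => /mulgI wy.
  have := xt y yt; rewrite (_ : (y / x = w^-1 * v)%g).
    by move/negP; case; apply/mem_set/(subgroupM sV) => //; exact: subgroupV.
  by apply: (@mulIg _ x); rewrite mulgVK -mulgA -wy mulKg.
Qed.

Lemma left_translate1 A : left_translate 1%g A = A.
Proof.
by apply/seteqP; split => x; [move=> [u Au <-]; rewrite mul1g|exists x; rewrite ?mul1g].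
Qed.

Lemma haar_transversal V A t : is_subgroup V -> open V ->
  transversal V A t -> mu A = ((size t)%:R%:E * mu V)%E.
Proof.
move=> sV oV tt; have := haar_left_translate_transversal 1%g sV oV tt.
by rewrite !left_translate1.
Qed.

(** Finitely many translates of [U] cover any compact set. If [U] were null, so would be all compact
    sets and, by inner regularity, the whole group. *)
Lemma haar_gt0 U : compact_open_subgroup U -> (0 < mu U)%E.
Proof.
move=> [sU kU oU]; rewrite lt0e measure_ge0 andbT; apply/negP => /eqP U0.
case: hmu => /eqP + _ _ inner _; apply; rewrite inner; last exact: openT.
apply/eqP; rewrite eq_le; apply/andP; split; last first.
  by apply: ereal_sup_ubound; exists set0; rewrite ?measure0//; split => //;
    exact: compact0.
apply: ge_ereal_sup => _ [K [kK _] <-].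
have [t tc] := covering_exists sU oU kK.
have KU : K `<=` \big[setU/set0]_(x <- t) right_translate U x.
  move=> x /tc[y yt Uxy]; rewrite -bigcup_seq; exists y => //.
  by rewrite /= right_translateE.
have mt s : measurable (\big[setU/set0]_(x <- s) right_translate U x : set (borel_type
  G)).
  by apply: bigsetU_measurable => x _; exact: borel_right_translate.
have mK : measurable (K : set (borel_type G)).
  rewrite -[K]setCK; apply: measurableC; apply: borel_open; apply: closed_openC.
  exact: compact_closed.
apply: (@le_trans _ _ (mu (\big[setU/set0]_(x <- t) right_translate U x))).
  by apply: le_measure; rewrite ?inE.
elim: t {tc KU} => [|x t IH]; first by rewrite big_nil measure0.
rewrite big_cons; set B := \big[setU/set0]_(y <- t) _ in IH *.
apply: (@le_trans _ _ (mu (right_translate U x) + mu B)%E).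
  by apply: measureU2 => //; [exact: borel_right_translate|exact: mt].
by rewrite haar_right_translate// U0 add0e.
Qed.

Definition modular_ratio U g : R := fine (mu (left_translate g U)) / fine (mu U).

(** Through the intersection one reduces to nested subgroups, where numerator and denominator are
    multiplied by the same index. *)
Lemma modular_ratio_indep U V g : compact_open_subgroup U -> compact_open_subgroup V ->
  modular_ratio U g = modular_ratio V g.
Proof.
suff sub W U' : compact_open_subgroup W -> compact_open_subgroup U' -> W `<=` U' ->
    modular_ratio U' g = modular_ratio W g.
  move=> cU cV; have cUV := compact_open_subgroupI cU cV.
  by rewrite (sub _ _ cUV cU)// (sub _ _ cUV cV).
move=> cW cU' WU; have [t tt] := small_transversal cW cU' WU.
have [sW kW oW] := cW; have [sU' kU' oU'] := cU'.
rewrite /modular_ratio (haar_left_translate_transversal g sW oW tt).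
rewrite (haar_transversal sW oW tt) !fineM//.
- rewrite -mulf_div divff ?mul1r// pnatr_eq0 -lt0n.
  case: t tt => // -[_ c]; by have [] := c _ (subgroup1 sU').
- by rewrite ge0_fin_numE ?haar_fin.
- rewrite ge0_fin_numE// haar_fin//; apply: compact_image => //.
  exact: continuous_lmul.
Qed.

Lemma modular_ratio_conjugate U g : open U ->
  modular_ratio U g = fine (mu (conjugate g U)) / fine (mu U).
Proof. by move=> oU; rewrite haar_conjugate. Qed.

Lemma conjugate_compact_open g U : compact_open_subgroup U ->
  compact_open_subgroup (conjugate g U).
Proof.
move=> [sU kU oU]; split; first exact: is_subgroup_conjugate.
  by apply: compact_image => //; exact: continuous_conjugate.
have -> : conjugate g U = right_translate (left_translate g U) g^-1%g.
  apply/seteqP; split => x; first by move=> [u Uu <-]; exists (g * u)%g => //; exists u.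
  by move=> [_ [u Uu <-] <-]; exists u.
exact/open_right_translate/open_left_translate.
Qed.

Lemma haar_fine_gt0 U : compact_open_subgroup U -> 0 < fine (mu U).
Proof. by move=> cU; have [_ kU _] := cU; apply: fine_gt0;
  rewrite haar_gt0// haar_fin. Qed.

Lemma haar_fine_le U V : compact_open_subgroup U -> compact_open_subgroup V ->
  U `<=` V -> fine (mu U) <= fine (mu V).
Proof.
move=> [_ kU oU] [_ kV oV] UV; apply: fine_le; rewrite ?ge0_fin_numE ?haar_fin//.
by apply: le_measure; rewrite ?inE; [exact: borel_open|exact: borel_open|].
Qed.

(* A coset of [U] in [V] that is disjoint from [U] has the measure of [U]. *)
Lemma haar_fine_eq U V : compact_open_subgroup U -> compact_open_subgroup V ->
  U `<=` V -> fine (mu U) = fine (mu V) -> V `<=` U.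
Proof.
move=> cU cV UV e x Vx; apply: contrapT => nUx.
have [sU kU oU] := cU; have [sV kV oV] := cV.
have mU : measurable (U : set (borel_type G)) by exact: borel_open.
have mUx : measurable (right_translate U x : set (borel_type G)).
  exact: borel_right_translate.
have d : U `&` right_translate U x = set0.
  apply/seteqP; split => // z [Uz]; rewrite right_translateE /= => Uzx; apply: nUx.
  have -> : x = ((z / x)^-1 * z)%g by rewrite invgF mulgVK.
  by apply: (subgroupM sU) => //; exact: subgroupV.
have : (mu (U `|` right_translate U x) <= mu V)%E.
  apply: le_measure; rewrite ?inE; [exact: measurableU|exact: borel_open|].
  move=> z [/UV//|[u /UV Vu <-]]; exact: subgroupM.
have -> : mu (U `|` right_translate U x) = (mu U + mu U)%E.
  by rewrite measureU//; congr (_ + _)%E; exact: haar_right_translate.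
have fU : mu U \is a fin_num by rewrite ge0_fin_numE ?haar_fin.
have fV : mu V \is a fin_num by rewrite ge0_fin_numE ?haar_fin.
rewrite -(fineK fU) -(fineK fV) -EFinD lee_fin -e.
by have := haar_fine_gt0 cU; lra.
Qed.

End Modular.

(* The ratio of the measures of [g W g^-1] and [W] does not depend on [W]; it is at least
   one for [W = U], and at most one if [g W g^-1] is contained in [W]. *)
Lemma modular_eq1 (R : realType) (G : topGroupType) (g : G) (U : set G) :
  van_dantzig G -> compact_open_subgroup U -> U `<=` conjugate g U ->
  modular R g = 1 <-> scale g = 1%N.
Proof.
move=> vG cU UgU; have [mu hmu] := right_haar_exists R vG; have hG := vG.1.
rewrite scale_eq1 /modular; set P := [set r | _].
have P1 : P !=set0 by exists (modular_ratio mu U g), mu, U.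
have Pval r : P r -> exists nu : {measure set (borel_type G) -> \bar R},
    right_haar nu /\ forall V, compact_open_subgroup V -> r = modular_ratio nu V g.
  move=> [nu [V [hnu cV ->]]]; exists nu; split => // W cW.
  exact: modular_ratio_indep.
have Pone r : P r -> r = 1 <-> exists2 W, compact_open_subgroup W & conjugate g W `<=` W.
  move=> /Pval[nu [hnu rE]].
  have ratio V : compact_open_subgroup V -> r = fine (nu (conjugate g V)) / fine (nu V).
    by move=> cV; rewrite (rE V cV) modular_ratio_conjugate//; case: cV.
  split=> [r1|[W cW gWW]].
    exists U => //; have := ratio U cU; rewrite r1 => /esym/divr1_eq e.
    apply: (haar_fine_eq hnu hG cU _ UgU); first exact: conjugate_compact_open.
    by rewrite e.
  apply/eqP; rewrite eq_le {1}(ratio W cW) (ratio U cU).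
  rewrite ler_pdivrMr ?(haar_fine_gt0 hnu hG cW)// ler_pdivlMr ?(haar_fine_gt0 hnu hG
    cU)// !mul1r.
  by rewrite !haar_fine_le//; exact: conjugate_compact_open.
exact: Pone (getPex P1).
Qed.

(** * Stabilizers of boundary points *)

Section InducedTopology.
Variables (G : topGroupType) (S : subgroup G).
Local Notation H := (subgroup_type S).
Implicit Types (A : set H) (B K : set G).

Lemma subgroup_valP (h : H) : subgroup_set S (val h).
Proof. exact/set_mem/(valP h). Qed.

Lemma val_continuous : continuous (val : H -> G).
Proof. exact: initial_continuous. Qed.

Lemma open_induced A : open A -> exists2 B, open B & A = val @^-1` B.
Proof. by case=> B oB <-; exists B. Qed.

Lemma open_val_preimage B : open B -> open (val @^-1` B : set H).
Proof. by move=> oB; apply: (iffLR (continuousP _)) => //; exact: val_continuous. Qed.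

(** A cluster point of the image filter is found in [G]; closedness puts it into [S]. *)
Lemma compact_val_preimage K : closed (subgroup_set S) -> compact K ->
  compact (val @^-1` K : set H).
Proof.
move=> cS cK F PF FK.
have [x [Kx clx]] := cK _ (fmap_proper_filter val PF) FK.
have Sx : subgroup_set S x.
  apply: cS => B nB.
  have Fr : F (val @^-1` (range (val : H -> G))) by apply: filterS filterT => h _;
    exists h.
  have [y [[h _ <-] By]] := clx (range val) B Fr nB.
  by exists (val h); split => //; exact: subgroup_valP.
exists (to_subgroup Sx); split => // C D FC.
rewrite nbhsE => -[D' [/open_induced[B oB DB] D'x] D'D].
have Bx : B x by move: D'x; rewrite DB.
have FvC : F (val @^-1` [set val h | h in C]) by apply: filterS FC => h Ch; exists h.
have [_ [[h Ch <-] Bh]] := clx [set val h | h in C] B FvC (open_nbhs_nbhs (conj oB Bx)).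
by exists h; split => //; apply: D'D; rewrite DB.
Qed.

Lemma van_dantzig_subgroup : closed (subgroup_set S) -> van_dantzig G -> van_dantzig H.
Proof.
move=> cS [hG bG]; split.
  move=> x y clxy; apply: val_inj; apply: hG => A B nA nB.
  have [h [Ah Bh]] := clxy (val @^-1` A) (val @^-1` B) (val_continuous nA)
    (val_continuous nB).
  by exists (val h).
move=> N; rewrite nbhsE => -[N' [/open_induced[B oB ->] B1] BN].
have [|U [sU kU oU] UB] := bG B; first by apply: open_nbhs_nbhs; split.
exists (val @^-1` U); last by move=> h /UB/BN.
split; [|exact: compact_val_preimage|exact: open_val_preimage].
split; first exact: sU.1.
by move=> x y Ux Uy; exact: (sU.2 _ _ Ux Uy).
Qed.

End InducedTopology.

Lemma infinite_pigeonhole (T : choiceType) (s : seq T) (P : nat -> T -> Prop) :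
  (forall n, exists2 y, y \in s & P n y) ->
  exists2 y, y \in s & forall N, exists2 n, (N <= n)%N & P n y.
Proof.
move=> H; apply: contrapT => H0.
have {}H0 y : exists N, y \in s -> forall n, (N <= n)%N -> ~ P n y.
  apply: contrapT => /forallNP H1; apply: H0.
  have [ys|ys] := boolP (y \in s); last by case: (H1 0%N) => ys'; rewrite ys' in ys.
  exists y => // N; apply: contrapT => H2; apply: (H1 N) => _ n Nn Pn.
  by apply: H2; exists n.
have [f fP] := choice H0.
have [y ys] := H (\max_(z <- s) f z)%N.
by apply: (fP y ys); exact: leq_bigmax_seq.
Qed.

(** * Openness of stabilizers and dynamics of conjugation *)

Section Action.
Variables (G : topGroupType) (R : realType) (X : metricType R) (a : isometric_action G X).
Variable (k : npc_kind).
Hypotheses (hX : npc_space k X) (ca : continuous_action a) (pa : proper_action a).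
Implicit Types (g h : G) (x y : X) (xi : boundary X) (U V K : set G).

Lemma action_near h x (e : R) : 0 < e ->
  \forall h' \near h, mdist (a h x) (a h' x) < e.
Proof.
move=> e0; have c : continuous (fun h' => a h' x).
  move=> h'; apply: (@continuous_comp _ _ _ (fun h' => (h', x)) (fun p : G * X => a p.1
    p.2)).
    by apply: cvg_pair; [exact: cvg_id|exact: cvg_cst].
  exact: ca.
have := c h _ (nbhsx_ballx (a h x) e e0).
by rewrite ballEmdist.
Qed.

Lemma compact_displacement K x : compact K ->
  exists C : R, forall h, K h -> mdist (a h x) x <= C.
Proof.
move=> /compact_near_coveringP/(_ nat \oo (fun n h => mdist (a h x) x <= n%:R) _).
case=> [h Kh|N _ HN]; last by exists N%:R => h Kh; apply: (HN N) => //=.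
exists ([set h' | mdist (a h x) (a h' x) < 1], [set n | (Num.trunc (mdist (a h x) x +
  1) < n)%N]).
  split; first exact: action_near.
  by exists (Num.trunc (mdist (a h x) x + 1)).+1.
move=> [h' n] /= [h1 h2].
have h3 : mdist (a h x) x + 1 <= n%:R.
  by apply: le_trans (ltW (truncnS_gt _)) _; rewrite ler_nat.
by have := mdist_triangle (a h x) (a h' x) x; rewrite (mdist_sym (a h' x) (a h x)); lra.
Qed.

(** An element of the stabilizer that is close to [h] at both [x] and [g^n x] depends on [n], but
    its displacement bound does not; hence [h] too has bounded displacement along the orbit. *)
Lemma attracting_stabilizer_closed g xi : hyperbolic a k g -> attracting a k g xi ->
  closed (stabilizer_set a xi).
Proof.
move=> hg gxi h clh; have [c _ _] := boundary_nonempty xi; set x := c 0.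
have [C' HC'] := displacement_bound hX x (mdist (a h x) x + 1) hg gxi.
apply: (bounded_displacement_fixes (x := x) (C := C' + 2) hX gxi) => n.
have n1 := action_near h x (ltr01).
have n2 := action_near h (a (g ^+ n)%g x) (ltr01).
have [h' [Sh' [/= h1 h2]]] := clh _ (filterI n1 n2).
have := HC' h' Sh' _ n.
have := mdist_triangle (a h x) (a h' x) x; rewrite (mdist_sym (a h' x) (a h x)).
have := mdist_triangle (a h' (a (g ^+ n)%g x)) (a h (a (g ^+ n)%g x)) (a (g ^+ n)%g x).
move: h1 h2 => h1 h2 h3 h4 H; have {}H : mdist (a h' (a (g ^+ n)%g x)) (a (g ^+ n)%g x)
  <= C'.
  by apply: H; lra.
lra.
Qed.

Lemma conj_iter g n h : iter n (fun h => (g * h / g)%g) h = (g ^+ n * h / g ^+ n)%g.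
Proof.
elim: n => [|n IH] /=; first by rewrite expg0 mul1g divg1.
by rewrite IH expgS invgM !mulgA.
Qed.

Lemma conj_morph g : {morph (fun h => (g * h / g)%g) : x y / (x * y)%g}.
Proof. by move=> x y; rewrite !mulgA mulgVK. Qed.

Lemma conj_cancel g : cancel (fun h => (g * h / g)%g) (fun h => (g^-1 * h / g^-1)%g).
Proof. by move=> h; rewrite invgK !mulgA mulVg mul1g mulgVK. Qed.

Lemma conj_cancelV g : cancel (fun h => (g^-1 * h / g^-1)%g) (fun h => (g * h / g)%g).
Proof. by move=> h; rewrite invgK !mulgA mulgV mul1g mulgK. Qed.

(** Trades the orbit for the single point [x], at which properness turns a bound into
    compactness. *)
Lemma displacement_conj g h x n :
  mdist (a h (a (g ^+ n)%g x)) (a (g ^+ n)%g x) = mdist (a (g^-1 ^+ n * h / g^-1 ^+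
    n)%g x) x.
Proof.
rewrite expVgn invgK -(act_isometry a (g ^- n)%g).
by rewrite actK -!actM.
Qed.

Lemma backward_bounded_fixes g xi V h : compact V -> attracting a k g xi ->
  (forall n, V (g^-1 ^+ n * h / g^-1 ^+ n)%g) -> boundary_act a h xi = xi.
Proof.
move=> kV gxi Vh; have [c _ _] := boundary_nonempty xi.
have [C HC] := compact_displacement (c 0) kV.
apply: (bounded_displacement_fixes (x := c 0) (C := C) hX gxi) => n.
by rewrite displacement_conj; exact: HC.
Qed.

Theorem scale1_open_stabilizer g xi : van_dantzig G ->
  hyperbolic a k g -> attracting a k g^-1 xi ->
  scale g = 1%N <-> open (stabilizer_set a xi).
Proof.
move=> vG hg gxi; have hgV := hyperbolicV hg.
rewrite scale_eq1; split=> [[U cU gU]|oS].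
  have [sU kU oU] := cU.
  apply: subgroup_open; first exact: stabilizer_subproof.
  apply: (@filterS _ _ _ U); last by apply: open_nbhs_nbhs; split => //; exact: subgroup1.
  move=> h Uh; apply: (backward_bounded_fixes kU gxi) => n; rewrite invgK -conj_iter.
  by elim: n => //= n IH; apply: gU; exists (iter n (fun h => (g * h / g)%g) h).
have [V cV VS] : exists2 V, compact_open_subgroup V & V `<=` stabilizer_set a xi.
  by apply: vG.2; apply: open_nbhs_nbhs; split => //;
    exact: subgroup1 (stabilizer_subproof a xi).
have [sV kV oV] := cV; have [c _ _] := boundary_nonempty xi; set x := c 0.
have [C HC] := compact_displacement x kV.
have [C' HC'] := displacement_bound hX x C hgV gxi.
have r0 : 0 < `|C'| + 1 by have := normr_ge0 C'; lra.
have [|T cT gT] := invariant_subgroup (@conj_morph g) (@conj_morph g^-1%g)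
  (@conj_cancel g)
  (@conj_cancelV g) (continuous_conjugate (g := g)) (continuous_conjugate (g :=
    g^-1%g)) vG.1 cV
  (pa (x := x) r0).
  move=> n h Vh; apply: subset_closure => /=; rewrite conj_iter.
  have := HC' h (VS h Vh) (HC h Vh) n; rewrite displacement_conj invgK.
  by have := ler_norm C'; lra.
by exists T => // _ [u Tu <-]; exact: gT.
Qed.

Lemma open_stabilizer_of_le g xip xim : van_dantzig G ->
  attracting a k g xip -> attracting a k g^-1 xim ->
  stabilizer_set a xip `<=` stabilizer_set a xim -> open (stabilizer_set a xim).
Proof.
move=> vG hp hm le.
have [V cV _] := vG.2 setT filterT; have [sV kV oV] := cV.
have [N tidy] := tidy_above (@conj_morph g) (@conj_morph g^-1%g) (@conj_cancel g)
  (@conj_cancelV g) (continuous_conjugate (g := g)) (continuous_conjugate (g :=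
    g^-1%g)) cV.
have sS := stabilizer_subproof a xim.
apply: subgroup_open => //.
have [sT kT oT] := trunc_compact_open (@conj_morph g^-1%g) (continuous_conjugate (g :=
  g^-1%g)) N cV.
apply: filterS (open_nbhs_nbhs (conj oT (subgroup1 sT))) => h Th.
have [p pp mp] := tidy h Th; rewrite -(mulVKg p h); apply: (subgroupM sS).
  apply: le; apply: (backward_bounded_fixes kV hp) => n.
  by rewrite -conj_iter; exact: pp.
apply: (backward_bounded_fixes kV hm) => n.
by rewrite invgK -conj_iter; exact: trunc0 (mp n).
Qed.

(** When [h^n x] is close to [g^m x], the element [h^-n g^m] fixes [xip], hence [xim], and moves [x]
    boundedly. So it moves [g^-m x] boundedly, and it sends this point to [h^-n x]: the backward
    orbit of [h] follows that of [g]. *)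
Lemma arrow_of_le g xip xim : hyperbolic a k g ->
  attracting a k g xip -> attracting a k g^-1 xim ->
  stabilizer_set a xip `<=` stabilizer_set a xim -> arrow a k xip xim.
Proof.
move=> hg hp hm le; split; [by exists g => //; left|by exists g => //; right|].
move=> h hh hhp x; have hgV := hyperbolicV hg.
have [C HC] := same_attracting_close hX x hg hh hp hhp.
have [C' HC'] := displacement_bound hX x C hgV hm.
apply: (tends_to_close (C := C') hX (hm x)) => M.
pose f := mdist x (a g x).
(* Beyond [N] the orbit of [h] is too far from [x] to be within [C] of some [g^m x] with [m < M]. *)
have [N HN] := orbit_escape hh x (C + M%:R * f + 1).
exists N => n Nn; have [m hm'] := HC n; exists m.
  rewrite leqNgt; apply/negP => mM.
  have := HN n Nn; have := mdist_triangle (a (g ^+ m)%g x) x (a (h ^+ n)%g x).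
  have : m%:R * f <= M%:R * f by rewrite ler_wpM2r ?mdist_ge0// ler_nat ltnW.
  have := orbit_le a g x m; rewrite -/f (mdist_sym (a (g ^+ m)%g x) (a (h ^+ n)%g x));
    lra.
have Sw : stabilizer_set a xim (h ^- n * g ^+ m)%g.
  have sS := stabilizer_subproof a xip; apply: le; apply: (subgroupM sS).
    apply: (subgroupV sS); apply: (subgroupX _ sS); exact: attracting_stabilizer hX hhp.
  by apply: (subgroupX _ sS); exact: attracting_stabilizer hX hp.
have wx : mdist (a (h ^- n * g ^+ m)%g x) x <= C.
  by rewrite -(act_isometry a (h ^+ n)%g) -!actM mulVKg mdist_sym.
have := HC' _ Sw wx m.
by rewrite -actM !expVgn -mulgA mulgV mulg1.
Qed.

(** For [u] fixing [xip], the conjugate [u g u^-1] is hyperbolic and again attracted by [xip], so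
    its repelling point is [xim]; but that point is also the image of [xim] under [u]. *)
Lemma le_of_arrow g xip xim : hyperbolic a k g ->
  attracting a k g xip -> attracting a k g^-1 xim -> arrow a k xip xim ->
  stabilizer_set a xip `<=` stabilizer_set a xim.
Proof.
move=> hg hp hm [_ _ arr] u uxip.
have [c _ _] := boundary_nonempty xim.
have := arr _ (hyperbolic_conj u hg).
have := attracting_conj u hp; rewrite {1}uxip => h1 /(_ h1) h2.
apply: (tends_to_unique hX (attracting_conj u hm (c 0))).
by have := h2 (c 0); rewrite invgF invgM mulgA.
Qed.

(* The conjugates [g^-n h g^n] of [h] in [G_xip] stay in a compact set; two of them in the
   same coset of the open subgroup [G_xip,xim] differ by an element that displaces
   the backward orbit of [x] boundedly. *)
Lemma le_of_open_stabilizer g xip xim : hyperbolic a k g ->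
  attracting a k g xip -> attracting a k g^-1 xim ->
  open (val @^-1` (stabilizer_set a xim `&` stabilizer_set a xip) :
    set (subgroup_type (stabilizer a xip))) ->
  stabilizer_set a xip `<=` stabilizer_set a xim.
Proof.
move=> hg hp hm oV h hS.
set V := val @^-1` _ in oV;
have hgV := hyperbolicV hg.
have sSp := stabilizer_subproof a xip; have sSm := stabilizer_subproof a xim.
have gSp : stabilizer_set a xip g := attracting_stabilizer hX hp.
have gSm : stabilizer_set a xim g.
  by rewrite -[g]invgK; apply: (subgroupV sSm); exact: attracting_stabilizer hX hm.
have sV : is_subgroup V.
  split; first by split; exact: subgroup1.
  by move=> u v [u1 u2] [v1 v2]; split; [exact: (sSm.2 _ _ u1 v1)|exact: (sSp.2 _ _ u2
    v2)].
have [c _ _] := boundary_nonempty xim; set x := c 0.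
have [C HC] := displacement_bound hX x (mdist (a h x) x) hg hp.
have hn n : stabilizer_set a xip (g ^- n * h * g ^+ n)%g.
  apply: (subgroupM sSp); last exact: subgroupX.
  by apply: (subgroupM sSp) => //; apply: (subgroupV sSp); exact: subgroupX.
have dn n : mdist (a (g ^- n * h * g ^+ n)%g x) x <= C.
  by have := HC h hS (lexx _) n; rewrite displacement_conj !expVgn invgK.
have r0 : 0 < `|C| + 1 by have := normr_ge0 C; lra.
have kQ := compact_val_preimage (S := stabilizer a xip)
  (attracting_stabilizer_closed hg hp) (pa (x := x) r0).
have [s [_ sQ]] := compact_finite_cosets sV oV kQ.
pose hS' n := to_subgroup (S := stabilizer a xip) (hn n).
have Qn n : exists2 y, y \in s & V (y^-1 * hS' n)%g.
  apply: sQ; apply: subset_closure => /=.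
  by have := dn n; have := ler_norm C; lra.
have [y ys yinf] := infinite_pigeonhole Qn.
have [n0 _ V0] := yinf 0%N.
pose h0 := (g ^- n0 * h * g ^+ n0)%g.
have [C' HC'] := displacement_bound hX x (C + C) hgV hm.
suff h0S : stabilizer_set a xim h0.
  have -> : h = (g ^+ n0 * h0 / g ^+ n0)%g.
    by rewrite /h0 !mulgA mulgV mul1g mulgK.
  apply: (subgroupM sSm); last by apply: (subgroupV sSm); exact: subgroupX.
  by apply: (subgroupM sSm) => //; exact: subgroupX.
apply: (bounded_displacement_fixes (x := x) (C := C' + C) hX hm) => j.
have [n jn Vn] := yinf j.
pose h1 := (g ^- n * h * g ^+ n)%g.
have uS : stabilizer_set a xim (h1^-1 * h0)%g.
  have := subgroupM sV (subgroupV sV Vn) V0; rewrite invgM invgK mulgA mulgK.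
  by case.
have ux : mdist (a (h1^-1 * h0)%g x) x <= C + C.
  rewrite -(act_isometry a h1) -actM mulVKg.
  have := mdist_triangle x (a h0 x) (a h1 x); have := dn n; have := dn n0.
  by rewrite -/h0 -/h1 (mdist_sym x (a h1 x)); lra.
have := HC' _ uS ux j.
set p := a (g^-1 ^+ j)%g x.
rewrite -(act_isometry a h1) -actM mulVKg => d1.
(* As [n >= j], the point [p] is the image under [g^-n] of a point of the forward orbit, where the
   displacement of [h] is at most [C]. *)
have d2 : mdist (a h1 p) p <= C.
  have -> : p = a (g ^- n * g ^+ (n - j))%g x by rewrite expgnFr// mulKg /p expVgn.
  rewrite -actM /h1 mulgA mulgK -mulgA !(actM a (g ^- n)%g) act_isometry actM.
  exact: HC.
by have := mdist_triangle (a h1 p) (a h0 p) p; lra.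
Qed.

End Action.

(** * Restriction of the action to a subgroup *)

Section RestrictedAction.
Variables (G : topGroupType) (R : realType) (X : metricType R) (a : isometric_action G X).
Variable S : subgroup G.
Local Notation H := (subgroup_type S).
Implicit Types (h : H) (x y : X) (xi : boundary X).

Let ract h x := a (val h) x.

Let ract1 x : ract 1%g x = x.
Proof. by rewrite /ract val1 act1. Qed.

Let ractM h1 h2 x : ract (h1 * h2)%g x = ract h1 (ract h2 x).
Proof. by rewrite /ract valM actM. Qed.

Let ract_isometry h x y : mdist (ract h x) (ract h y) = mdist x y.
Proof. exact: act_isometry. Qed.

Definition restrict_action : isometric_action H X := IsometricAction ract1 ractM
  ract_isometry.

Lemma val_expg h n : val (h ^+ n)%g = (val h ^+ n)%g.
Proof. exact: gmulfXn. Qed.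

Lemma val_invg h : val h^-1%g = (val h)^-1%g.
Proof. exact: gmulfV. Qed.

Lemma restrict_hyperbolic k h : hyperbolic restrict_action k h <-> hyperbolic a k (val h).
Proof.
case: k => //=.
have zE i : val (expgz h i) = expgz (val h) i.
  by case: i => i; rewrite /= ?val_invg val_expg.
split=> -[x [L [C [L1 C0 Hx]]]]; exists x, L, C; split => // m n;
  have := Hx m n; by rewrite /= /ract !zE.
Qed.

Lemma restrict_attracting k h xi :
  attracting restrict_action k h xi <-> attracting a k (val h) xi.
Proof.
by split=> H' x; have := H' x; congr tends_to; apply/funext => n /=;
  rewrite /ract val_expg.
Qed.

Lemma restrict_stabilizer xi :
  stabilizer_set restrict_action xi = val @^-1` stabilizer_set a xi.
Proof.
apply/seteqP; split => h /= hxi; rewrite /stabilizer_set /= -[RHS]hxi;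
  exact: boundary_ext.
Qed.

Lemma restrict_continuous : continuous_action a -> continuous_action restrict_action.
Proof.
move=> ca p; apply: (@continuous_comp _ _ _ (fun p : H * X => (val p.1, p.2))
  (fun q : G * X => a q.1 q.2)); last exact: ca.
apply: cvg_pair; last exact: cvg_snd.
by apply: (cvg_comp _ val) (@val_continuous _ _ _); exact: cvg_fst.
Qed.

Lemma restrict_proper : closed (subgroup_set S) -> proper_action a ->
  proper_action restrict_action.
Proof.
move=> cS pa x r r0.
apply: subclosed_compact (compact_val_preimage cS (pa x r r0)) _;
  first exact: closed_closure.
move=> h clh B nB.
have [h' [h'r Bh']] := clh _ (val_continuous nB).
by exists (val h').
Qed.

End RestrictedAction.

Theorem theorem1p4 (R : realType) (k : npc_kind) (X : metricType R)
    (hX : npc_space k X) (G : topGroupType) (hG : tdlc G)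
    (a : isometric_action G X) (ca : continuous_action a) (pa : proper_action a)
    (g : G) (hg : hyperbolic a k g) (xip xim : boundary X)
    (hp : attracting a k g xip) (hm : repelling a k g xim) :
  let Gp := subgroup_type (stabilizer a xip) in
  let gp : Gp := to_subgroup (attracting_stabilizer hX hp) in
  [<-> scale g = 1%N;
       scale gp = 1%N;
       modular R gp = 1;
       open (stabilizer_set a xim);
       open (val @^-1` (stabilizer_set a xim `&` stabilizer_set a xip) : set Gp);
       stabilizer_set a xip `<=` stabilizer_set a xim;
       arrow a k xip xim].
Proof.
move=> Gp gp.
have vG := tdlc_van_dantzig hG.
have cS : closed (subgroup_set (stabilizer a xip)) :=
  attracting_stabilizer_closed hX ca hg hp.
have vGp : van_dantzig Gp := van_dantzig_subgroup cS vG.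
pose b := restrict_action a (stabilizer a xip).
have cb : continuous_action b := restrict_continuous ca.
have pb : proper_action b := restrict_proper cS pa.
have hgp : hyperbolic b k gp by apply/restrict_hyperbolic.
have hgpV : hyperbolic b k gp^-1%g by exact: hyperbolicV.
have gpm : attracting b k gp^-1%g xim.
  by apply/restrict_attracting; rewrite val_invg.
have gpp : attracting b k gp^-1^-1%g xip.
  by rewrite invgK; apply/restrict_attracting.
have e14 : scale g = 1%N <-> open (stabilizer_set a xim).
  exact: (scale1_open_stabilizer hX ca pa vG hg hm).
have Sval (h : Gp) : stabilizer_set a xip (val h) := subgroup_valP h.
have vpre : val @^-1` (stabilizer_set a xim `&` stabilizer_set a xip) =
    val @^-1` stabilizer_set a xim :> set Gp.
  by apply/seteqP; split => [h []//|h hm']; split => //; exact: Sval.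
have e25 : scale gp = 1%N <->
    open (val @^-1` (stabilizer_set a xim `&` stabilizer_set a xip) : set Gp).
  rewrite (scale1_open_stabilizer hX cb pb vGp hgp gpm) restrict_stabilizer.
  by rewrite vpre.
have [U cU gU] : exists2 U, compact_open_subgroup U & conjugate gp^-1%g U `<=` U.
  apply/scale_eq1/(scale1_open_stabilizer hX cb pb vGp hgpV gpp).
  rewrite restrict_stabilizer (_ : _ @^-1` _ = setT); first exact: openT.
  by apply/seteqP; split => // h _; exact: Sval.
have UgU : U `<=` conjugate gp U.
  move=> u Uu; exists (gp^-1 * u / gp^-1)%g; last first.
    by rewrite invgK !mulgA mulgV mul1g mulgK.
  by apply: gU; exists u.
have e32 : modular R gp = 1 <-> scale gp = 1%N := modular_eq1 R vGp cU UgU.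
have e45 : open (stabilizer_set a xim) ->
    open (val @^-1` (stabilizer_set a xim `&` stabilizer_set a xip) : set Gp).
  by move=> oS; rewrite vpre; exact: open_val_preimage.
have e56 := le_of_open_stabilizer hX ca pa hg hp hm.
have e64 := open_stabilizer_of_le hX ca vG hp hm.
have e67 := arrow_of_le hX hg hp hm.
have e76 := le_of_arrow hX hg hp hm.
tfae.
- by move/e14/e45/e25.
- by move/e32.
- by move/e32/e25/e56/e64.
- exact: e45.
- exact: e56.
- exact: e67.
- by move/e76/e64/e14.
Qed.
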